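(* Let $C_4$ be the 4-cycle. Suppose $W$ is a $C_4$-regular graphon with $t(C_4,W)>0$, and suppose that it is not the case that $W=1$ a.e. on $[0,1]^2$. Then the limit in distribution, as $n\to\infty$, of $$Z_n(C_4,W):=\frac{X_n(C_4,W)-\frac{(n)_4}{|\mathrm{Aut}(C_4)|}t(C_4,W)}{n^3},$$ namely the law of $\sigma_{C_4,W}\cdot Z+\sum_{\lambda\in\mathrm{Spec}^-(W_{C_4})}\lambda(Z_\lambda^2-1)$ with $Z$ and $\{Z_\lambda\}$ independent standard Gaussians, is non-degenerate (i.e. not almost surely constant).
   Context: A graphon is a measurable symmetric function $W:[0,1]^2\to[0,1]$. Let $\{U_i\}_{i\ge1}$ and $\{Y_{ij}\}_{i<j}$ be mutually independent families of i.i.d. uniform $[0,1]$ random variables. The $W$-random graph $G(n,W)$ on $\{1,\ldots,n\}$ contains the edge $\{i,j\}$ iff $Y_{ij}\le W(U_i,U_j)$. For a simple graph $H$ on $V(H)=\{1,\ldots,|V(H)|\}$, $X_n(H,W)$ is the number of (unlabelled) copies of $H$ in $G(n,W)$. $\mathrm{Aut}(H)$ is the automorphism group of $H$; $(n)_k=n(n-1)\cdots(n-k+1)$. For a finite loopless multigraph $F$, $t(F,W)=\int_{[0,1]^{|V(F)|}}\prod_{(a,b)\in E(F)}W(x_a,x_b)\prod_adx_a$, edges taken with multiplicity. For distinct vertices $a_1,\ldots,a_K$ of $H$, $t_{a_1,\ldots,a_K}((x_1,\ldots,x_K),H,W)$ is obtained by fixing the variable of vertex $a_j$ to be $x_j$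 and integrating $\prod_{(a,b)\in E(H)}W$ over the remaining vertex variables in $[0,1]$. $W$ is $H$-regular if $\frac1{|V(H)|}\sum_at_a(x,H,W)=t(H,W)$ for a.e. $x\in[0,1]$. $E^+(H)$ is the set of ordered pairs of adjacent vertices of $H$. For $(a,b),(c,d)\in E^+(H)$, take two disjoint copies of $H$, identify vertex $a$ of the first with vertex $c$ of the second and vertex $b$ of the first with vertex $d$ of the second; $H\ominus_{(a,b),(c,d)}H$ keeps a single edge between the two identified vertices and $H\oplus_{(a,b),(c,d)}H$ keeps both (a double edge). Then $\sigma_{H,W}\ge0$ is defined by $\sigma^2_{H,W}=\frac1{2|\mathrm{Aut}(H)|^2}\sum_{(a,b),(c,d)\in E^+(H)}\big[t(H\ominus_{(a,b),(c,d)}H,W)-t(H\oplus_{(a,b),(c,d)}H,W)\big]$. $W_H(x,y)=\frac1{2|\mathrm{Aut}(H)|}\sum_{1\le a\ne b\le|V(H)|}t_{a,b}((x,y),H,W)$ (ordered pairs). $\mathrm{Spec}(W_H)$ is the multiset of non-zero eigenvalues of the integral operator on $L^2[0,1]$ with kernel $W_H$. When $W$ is $H$-regular, $\int_0^1W_H(x,y)\,dy=d_{W_H}:=\frac{|V(H)|(|V(H)|-1)}{2|\mathrm{Aut}(H)|}t(H,W)$ for a.e. $x$, so $d_{W_H}$ is an eigenvalue with eigenfunction $1$; $\mathrm{Spec}^-(W_H)$ is $\mathrm{Spec}(W_H)$ with the multiplicity of $d_{W_H}$ decreased by $1$. For $H$-regular $W$, $Z_n(H,W):=\big(X_n(H,W)-\frac{(n)_{|V(H)|}}{|\mathrm{Aut}(H)|}t(H,W)\big)/n^{|V(H)|-1}$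 converges in distribution to $\sigma_{H,W}Z+\sum_{\lambda\in\mathrm{Spec}^-(W_H)}\lambda(Z_\lambda^2-1)$. *)

(* Defs.v *)
From HB Require Import structures.
From mathcomp Require Import all_boot all_order all_algebra.
From mathcomp Require Import perm.
From mathcomp Require Import all_classical all_reals all_analysis.

Set Implicit Arguments.
Unset Strict Implicit.
Unset Printing Implicit Defensive.

Import Order.TTheory GRing.Theory Num.Theory.
Import numFieldNormedType.Exports.

Local Open Scope classical_set_scope.
Local Open Scope ring_scope.

Record sgraph := SGraph {
  nv : nat;
  adj : rel 'I_nv;
  adj_sym : symmetric adj;
  adj_irr : irreflexive adj }.

Arguments adj : clear implicits.

(* Finite loopless multigraphs with vertices in an ambient eqType; each edge
   occurs in [medges], in one of its two orientations, as many times as its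
   multiplicity. *)
Record mgraph (V : eqType) := MGraph {
  mverts : seq V;
  medges : seq (V * V) }.

Definition sedges (H : sgraph) : seq ('I_(nv H) * 'I_(nv H)) :=
  [seq e : 'I_(nv H) * 'I_(nv H) <- enum {: 'I_(nv H) * 'I_(nv H)} |
    (e.1 < e.2)%N && adj H e.1 e.2].

Definition mgraph_of (H : sgraph) : mgraph 'I_(nv H) :=
  MGraph (enum 'I_(nv H)) (sedges H).

Definition card_Aut (H : sgraph) : nat :=
  #|[set s : 'S_(nv H) |
      [forall a, forall b, adj H (s a) (s b) == adj H a b]]%SET|.

(* A subgraph of the complete graph on 'I_n is a vertex set together with a set
   of two-element subsets; a copy of H in G is a subgraph of G isomorphic to H,
   that is, the image of H under some injective homomorphism. *)
Definition sgraph_image (H : sgraph) (n : nat) (f : {ffun 'I_(nv H) -> 'I_n}) :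
    {set 'I_n} * {set {set 'I_n}} :=
  ([set f a | a : 'I_(nv H)],
   [set [set f e.1; f e.2]%SET
      | e : 'I_(nv H) * 'I_(nv H) in [pred e | adj H e.1 e.2]])%SET.

Definition num_copies (H : sgraph) (n : nat) (G : rel 'I_n) : nat :=
  #|[set sgraph_image f | f : {ffun 'I_(nv H) -> 'I_n} in
       [pred f : {ffun 'I_(nv H) -> 'I_n} | injectiveb f &&
          [forall a, forall b, adj H a b ==> G (f a) (f b)]]]%SET|.

(* The second copy of H (the [inr] vertices) is attached to the first one by
   sending its vertex c to a and its vertex d to b. *)
Definition glue (k : nat) (a b c d : 'I_k) (v : 'I_k + 'I_k) : 'I_k + 'I_k :=
  match v with
  | inl _ => v
  | inr u => if u == c then inl a else if u == d then inl b else v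
  end.

Definition glue_edge (k : nat) (a b c d : 'I_k) (e : 'I_k * 'I_k) :
    ('I_k + 'I_k) * ('I_k + 'I_k) :=
  (glue a b c d (inr e.1), glue a b c d (inr e.2)).

Definition glued_verts (k : nat) (a b c d : 'I_k) : seq ('I_k + 'I_k) :=
  undup [seq glue a b c d v | v <- enum {: 'I_k + 'I_k}].

Definition oplus (H : sgraph) (a b c d : 'I_(nv H)) :
    mgraph ('I_(nv H) + 'I_(nv H))%type :=
  MGraph (glued_verts a b c d)
    ([seq (inl e.1, inl e.2) | e <- sedges H] ++
     [seq glue_edge a b c d e | e <- sedges H]).

Definition ominus (H : sgraph) (a b c d : 'I_(nv H)) :
    mgraph ('I_(nv H) + 'I_(nv H))%type :=
  MGraph (glued_verts a b c d)
    ([seq (inl e.1, inl e.2) | e <- sedges H] ++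
     [seq glue_edge a b c d e | e <- sedges H & e \notin [:: (c, d); (d, c)]]).

Definition C4_adj : rel 'I_4 :=
  fun a b => ((a.+1 %% 4)%N == b) || ((b.+1 %% 4)%N == a).

Fact C4_adj_sym : symmetric C4_adj.
Proof. by move=> a b; rewrite /C4_adj orbC. Qed.

Fact C4_adj_irr : irreflexive C4_adj.
Proof. by case=> [[|[|[|[|]]]]]. Qed.

Definition C4 : sgraph := SGraph C4_adj_sym C4_adj_irr.

Definition I01 {R : realType} : set R := `[0%R, 1%R]%classic.

(* Only the values of W on the unit square matter. *)
Definition is_graphon (R : realType) (W : R * R -> R) : Prop :=
  [/\ measurable_fun (@I01 R `*` @I01 R) W,
      forall x y, I01 x -> I01 y -> W (x, y) = W (y, x) &
      forall x y, I01 x -> I01 y -> 0 <= W (x, y) <= 1].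

(* Integral of f over [0,1]^s, the coordinates outside s being given by x. *)
Fixpoint int_cube (R : realType) (V : eqType) (s : seq V) (f : (V -> R) -> R)
    (x : V -> R) : R :=
  if s is v :: s' then
    \int[lebesgue_measure]_(u in I01)
       int_cube s' f [eta x with v |-> u]
  else f x.

(* t_{a_1,...,a_K}((x_1,...,x_K), F, W), for as = [a_1; ...; a_K] uniq. *)
Definition t_marked (R : realType) (V : eqType) (F : mgraph V) (W : R * R -> R)
    (as_ : seq V) (xs : seq R) : R :=
  int_cube [seq v <- mverts F | v \notin as_]
    (fun x => \prod_(e <- medges F) W (x e.1, x e.2))
    (fun v => nth 0 xs (index v as_)).

Definition t_dens (R : realType) (V : eqType) (F : mgraph V) (W : R * R -> R) :
  R := t_marked F W [::] [::].

Definition H_regular (R : realType) (H : sgraph) (W : R * R -> R) : Prop :=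
  {ae lebesgue_measure, forall x : R, I01 x ->
    (nv H)%:R^-1 * (\sum_(a < nv H) t_marked (mgraph_of H) W [:: a] [:: x])
    = t_dens (mgraph_of H) W}.

Definition sigma2 (R : realType) (H : sgraph) (W : R * R -> R) : R :=
  (2 * (card_Aut H)%:R ^+ 2)^-1 *
  \sum_(p : 'I_(nv H) * 'I_(nv H) | adj H p.1 p.2)
  \sum_(q : 'I_(nv H) * 'I_(nv H) | adj H q.1 q.2)
    (t_dens (ominus p.1 p.2 q.1 q.2) W - t_dens (oplus p.1 p.2 q.1 q.2) W).

Definition sigmaH (R : realType) (H : sgraph) (W : R * R -> R) : R :=
  Num.sqrt (sigma2 H W).

Definition WH (R : realType) (H : sgraph) (W : R * R -> R) (x y : R) : R :=
  (2 * (card_Aut H)%:R)^-1 *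
  \sum_(a < nv H) \sum_(b < nv H | a != b)
    t_marked (mgraph_of H) W [:: a; b] [:: x; y].

Definition dWH (R : realType) (H : sgraph) (W : R * R -> R) : R :=
  (nv H * (nv H).-1)%N%:R / (2 * (card_Aut H)%:R) * t_dens (mgraph_of H) W.

(* Everything is up to almost everywhere equality on [0,1]; the zero function
   is included, so that these functions form the eigenspace of l. *)
Definition eigenfunction (R : realType) (K : R -> R -> R) (l : R) (f : R -> R) :
    Prop :=
  [/\ measurable_fun I01 f,
      (@lebesgue_measure R).-integrable I01 (fun x => (f x ^+ 2)%:E) &
      {ae lebesgue_measure, forall x : R, I01 x ->
        \int[lebesgue_measure]_(y in I01) (K x y * f y) = l * f x}].

(* The dimension is that of a subspace of L^2[0,1]: linear independence and
   spanning are modulo a.e. equality. *)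
Definition eigen_dim (R : realType) (K : R -> R -> R) (l : R) (m : nat) : Prop :=
  exists phi : 'I_m -> R -> R,
    [/\ forall i, eigenfunction K l (phi i),
        forall c : 'I_m -> R,
          {ae lebesgue_measure, forall x : R, I01 x ->
            \sum_(i < m) c i * phi i x = 0} ->
          forall i, c i = 0 &
        forall f, eigenfunction K l f ->
          exists c : 'I_m -> R,
            {ae lebesgue_measure, forall x : R, I01 x ->
              f x = \sum_(i < m) c i * phi i x}].

(* lam lists Spec^-: each non-zero l occurs in lam as many times as its
   multiplicity as an eigenvalue, once less for l = d. As Spec^- may be finite
   (or empty), lam may also take the value 0, any number of times; such terms
   do not contribute to the limit law. *)
Definition enum_spec_minus (R : realType) (K : R -> R -> R) (d : R)
    (lam : nat -> R) : Prop :=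
  forall l : R, l != 0 -> exists m : nat,
    eigen_dim K l m /\ ([set i | lam i = l] #= `I_(m - (l == d))%N)%card.

Definition mutually_independent (d : measure_display) (T : measurableType d)
    (R : realType) (P : probability T R) (I : eqType) (D : pred I)
    (X : I -> T -> R) : Prop :=
  forall s : seq I, uniq s -> all D s ->
  forall B : I -> set R, (forall i, measurable (B i)) ->
    P (\big[setI/setT]_(i <- s) (X i @^-1` B i)) =
    (\prod_(i <- s) P (X i @^-1` B i))%E.

Definition has_law (d : measure_display) (T : measurableType d)
    (R : realType) (P : probability T R) (X : {RV P >-> R})
    (mu : set R -> \bar R) : Prop :=
  forall A : set R, measurable A -> distribution P X A = mu A.

(* The randomness of G(n, W): vertex variables U_i and edge variables Y_ij
   with i < j, all of them independent; Y_ij is unused for j <= i. The U_i take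
   all their values in [0,1], the domain of a graphon. *)
Definition graph_sample (d : measure_display) (T : measurableType d)
    (R : realType) (P : probability T R) (U : nat -> {RV P >-> R})
    (Y : nat -> nat -> {RV P >-> R}) : Prop :=
  [/\ forall i w, I01 (U i w),
      forall i, has_law (U i) (uniform_prob (@ltr01 R)),
      forall i j, (i < j)%N -> has_law (Y i j) (uniform_prob (@ltr01 R)) &
      mutually_independent P
        (fun u : nat + nat * nat =>
           match u with inl _ => true | inr e => (e.1 < e.2)%N end)
        (fun u => match u with inl i => U i | inr e => Y e.1 e.2 end)].

Definition W_random_graph (R : realType) (T : Type) (W : R * R -> R)
    (U : nat -> T -> R) (Y : nat -> nat -> T -> R) (n : nat) (w : T) :
    rel 'I_n :=
  fun i j => (i != j) &&
    let a := minn i j in let b := maxn i j in Y a b w <= W (U a w, U b w).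

Definition Xcount (R : realType) (T : Type) (H : sgraph) (W : R * R -> R)
    (U : nat -> T -> R) (Y : nat -> nat -> T -> R) (n : nat) (w : T) : nat :=
  num_copies H (W_random_graph W U Y (n := n) w).

Definition Zstat (R : realType) (T : Type) (H : sgraph) (W : R * R -> R)
    (U : nat -> T -> R) (Y : nat -> nat -> T -> R) (n : nat) (w : T) : R :=
  ((Xcount H W U Y n w)%:R
   - (n ^_ (nv H))%:R / (card_Aut H)%:R * t_dens (mgraph_of H) W)
  / n%:R ^+ (nv H).-1.

Definition cvg_in_law (d : measure_display) (T : measurableType d)
    (R : realType) (P : probability T R) (X : nat -> T -> R)
    (mu : probability R R) : Prop :=
  forall x : R, {for x, continuous (fun y : R => mu `]-oo, y]%classic)} ->
    P [set w | X n w <= x] @[n --> \oo] --> mu `]-oo, x]%classic.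

(* S is a version of sigma_{H,W} Z + sum_l l (Z_l^2 - 1), l in Spec^-(W_H),
   where Z and the Z_l are independent standard Gaussians; the series converges
   almost surely. *)
Definition limit_variable (d : measure_display) (T : measurableType d)
    (R : realType) (P : probability T R) (H : sgraph) (W : R * R -> R)
    (lam : nat -> R) (Z : {RV P >-> R}) (Zl : nat -> {RV P >-> R})
    (S : {RV P >-> R}) : Prop :=
  [/\ enum_spec_minus (WH H W) (dWH H W) lam,
      has_law Z (normal_prob 0 1) /\ (forall i, has_law (Zl i) (normal_prob 0 1)),
      mutually_independent P xpredT
        (fun o : option nat => if o is Some i then Zl i else Z) &
      {ae P, forall w,
        sigmaH H W * Z w + \sum_(0 <= i < n) lam i * (Zl i w ^+ 2 - 1)
          @[n --> \oo] --> S w}].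

Definition nondegenerate_law (R : realType) (mu : probability R R) :
    Prop := ~ exists c : R, {ae mu, forall x, x = c}.

(* Main.v *)
Require Import Defs.
From HB Require Import structures.
From mathcomp Require Import all_boot all_order all_algebra.
From mathcomp Require Import all_classical all_reals all_analysis.
From mathcomp Require Import measurable_realfun ring lra.

Set Implicit Arguments.
Unset Strict Implicit.
Unset Printing Implicit Defensive.

Import Order.TTheory GRing.Theory Num.Theory.
Import numFieldNormedType.Exports.

Local Open Scope classical_set_scope.
Local Open Scope ring_scope.

(* If the limit S is constant, then sigma = 0 and Spec^- is empty: a term of the
   series is independent of the sum of the others, so the event that it is <= 0
   has probability 0 or 1, which a non-zero Gaussian term rules out.

   If Spec^- is empty, then W_{C4} - d has no non-zero eigenvalue, so it vanishes
   a.e. by Schmidt's theorem. Writing W_k for the k-th operator power of W and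
   t = t(C4, W), this reads 2 W W_3 + W_2^2 = 3 t a.e. If sigma = 0, then W is 0
   or 1 a.e. where W_3 > 0. Let a be the measure of A = {W W_3 > 0} and let
   s^2 = 3 t. Then W = 1 on A, W_2 = s off A, and W_2^2 = s^2 - 2 W_3 on A, so
   the integral of W_2^2 over A is s^2 a - 2 t = s^2 (a - 2/3). Suppose a < 1.
   Then s <= 1, because W_2 <= 1, and
     a^2 <= (int W)^2 <= int W_2 <= s (1 - a) + s sqrt (a (a - 2/3)),
   which contradicts a^4 + 2 a^3 - 2 a^2 - 4 a/3 + 1 > 0 on [2/3, 1]. Hence
   a = 1 and W = 1 a.e. *)

(** * Bounded measurable functions on probability spaces *)

(** The constant 3 t comes from counting: of the 12 ordered pairs of distinct vertices of C4, 8 are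
    adjacent and contribute W W_3, 4 are opposite and contribute W_2^2, while d is 12 t in the same
    normalisation. Subtracting d removes one copy of the eigenfunction 1, because regularity makes
    the rows of W_{C4} - d integrate to 0.

    Every summand of sigma^2 is non-negative, since doubling an edge multiplies the integrand by one
    more factor W <= 1. So sigma = 0 kills each summand, and the one that glues an edge to itself is
    the integral of W (1 - W) W_3^2.

    The term 2 t in the integral over A is 2 <W, W_3> = 2 <W_2, W_2>. The square root comes from
    Cauchy-Schwarz on A, and (int W)^2 <= int W_2 is Cauchy-Schwarz for the degree function. The
    final inequality is tight: the minimum of the quartic on [2/3, 1] is about 0.011.

    A weak limit is unique, which carries non-degeneracy from the law of S to every limit law mu. *)

Definition bounded_meas (R : realType) d (X : measurableType d) (f : X -> R) :=
  measurable_fun setT f /\ exists M, forall x, `|f x| <= M.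

Section BoundedMeas.
Context (R : realType) d (X : measurableType d).
Implicit Types f g : X -> R.

Lemma bm_cst (r : R) : bounded_meas (fun _ : X => r).
Proof. by split; [exact: measurable_cst | exists `|r|]. Qed.

Lemma bmD f g : bounded_meas f -> bounded_meas g ->
  bounded_meas (fun x => f x + g x).
Proof.
move=> [mf [M fM]] [mg [N gN]]; split; first exact: measurable_funD.
by exists (M + N) => x; rewrite (le_trans (ler_normD _ _))// lerD.
Qed.

Lemma bmM f g : bounded_meas f -> bounded_meas g ->
  bounded_meas (fun x => f x * g x).
Proof.
move=> [mf [M fM]] [mg [N gN]]; split; first exact: measurable_funM.
by exists (M * N) => x; rewrite normrM ler_pM.
Qed.

Lemma bmN f : bounded_meas f -> bounded_meas (fun x => - f x).
Proof.
move=> [mf [M fM]]; split; first exact: measurable_funN.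
by exists M => x; rewrite normrN.
Qed.

Lemma bmB f g : bounded_meas f -> bounded_meas g ->
  bounded_meas (fun x => f x - g x).
Proof. by move=> bf bg; apply: bmD => //; exact: bmN. Qed.

Lemma bmX f n : bounded_meas f -> bounded_meas (fun x => f x ^+ n).
Proof.
move=> [mf [M fM]]; split; first exact: measurable_funX.
by exists (M ^+ n) => x; rewrite normrX lerXn2r// nnegrE// (le_trans _ (fM x)).
Qed.

Lemma bm_norm f : bounded_meas f -> bounded_meas (fun x => `|f x|).
Proof.
move=> [mf [M fM]]; split; first exact: measurableT_comp.
by exists M => x; rewrite normr_id.
Qed.

Lemma bm_sum (I : Type) (s : seq I) (P : pred I) (F : I -> X -> R) :
  (forall i, P i -> bounded_meas (F i)) ->
  bounded_meas (fun x => \sum_(i <- s | P i) F i x).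
Proof.
move=> bF; elim: s => [|i s ih].
  by under eq_fun do rewrite big_nil; exact: bm_cst.
under eq_fun do rewrite big_cons.
case: (boolP (P i)) => // Pi.
by apply: bmD => //; exact: bF.
Qed.

Lemma bm_prod (I : Type) (s : seq I) (P : pred I) (F : I -> X -> R) :
  (forall i, P i -> bounded_meas (F i)) ->
  bounded_meas (fun x => \prod_(i <- s | P i) F i x).
Proof.
move=> bF; elim: s => [|i s ih].
  by under eq_fun do rewrite big_nil; exact: bm_cst.
under eq_fun do rewrite big_cons.
case: (boolP (P i)) => // Pi.
by apply: bmM => //; exact: bF.
Qed.

Lemma bm_indic (A : set X) : measurable A -> bounded_meas (\1_A : X -> R).
Proof.
move=> mA; split; first exact: measurable_indic.
by exists 1 => x; rewrite indicE; case: (_ \in _); rewrite ?normr0 ?normr1.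
Qed.

Lemma bm_comp d' (Y : measurableType d') (h : Y -> X) f :
  measurable_fun setT h -> bounded_meas f -> bounded_meas (fun y => f (h y)).
Proof.
move=> mh [mf [M fM]]; split; first exact: measurableT_comp mf mh.
by exists M => y.
Qed.

End BoundedMeas.

Ltac bm_tac := repeat first
  [ assumption | exact: bm_cst | apply: bmD | apply: bmB | apply: bmN
  | apply: bmM | apply: bmX | apply: bm_norm ].

Section BoundedInt.
Context (R : realType) d (X : measurableType d) (P : probability X R).
Implicit Types f g : X -> R.

Lemma bm_integrable f : bounded_meas f -> P.-integrable setT (EFin \o f).
Proof.
move=> [mf [M fM]]; apply: measurable_bounded_integrable => //.
- by rewrite [X in (X < _)%E](probability_setT P) ltry.
- exists M; split; [exact: num_real|move=> N MN x _].
  exact: le_trans (fM x) (ltW MN).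
Qed.

Lemma bm_intE f : bounded_meas f ->
  (\int[P]_x f x)%:E = (\int[P]_x (f x)%:E)%E.
Proof.
by move=> bf; rewrite /Rintegral fineK//; exact: integrable_fin_num (bm_integrable bf).
Qed.

Lemma bm_intD f g : bounded_meas f -> bounded_meas g ->
  \int[P]_x (f x + g x) = \int[P]_x f x + \int[P]_x g x.
Proof. by move=> bf bg; rewrite RintegralD//; exact: bm_integrable. Qed.

Lemma bm_intB f g : bounded_meas f -> bounded_meas g ->
  \int[P]_x (f x - g x) = \int[P]_x f x - \int[P]_x g x.
Proof. by move=> bf bg; rewrite RintegralB//; exact: bm_integrable. Qed.

Lemma bm_intZl r f : bounded_meas f ->
  \int[P]_x (r * f x) = r * \int[P]_x f x.
Proof. by move=> bf; rewrite RintegralZl//; exact: bm_integrable. Qed.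

Lemma bm_intZr r f : bounded_meas f ->
  \int[P]_x (f x * r) = (\int[P]_x f x) * r.
Proof. by move=> bf; rewrite RintegralZr//; exact: bm_integrable. Qed.

Lemma prob_int_cst r : \int[P]_x r = r.
Proof. by rewrite Rintegral_cst// [X in fine X]probability_setT mulr1. Qed.

Lemma bm_int_le f g : bounded_meas f -> bounded_meas g ->
  (forall x, f x <= g x) -> \int[P]_x f x <= \int[P]_x g x.
Proof. by move=> bf bg fg; apply: le_Rintegral => //; exact: bm_integrable. Qed.

Lemma Rint_ge0 f : (forall x, 0 <= f x) -> 0 <= \int[P]_x f x.
Proof. by move=> f0; apply: Rintegral_ge0. Qed.

Lemma Rint_eq f g : f =1 g -> \int[P]_x f x = \int[P]_x g x.
Proof. by move=> fg; apply: eq_Rintegral => x _. Qed.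

Lemma bm_int_norm f M : bounded_meas f -> (forall x, `|f x| <= M) ->
  `|\int[P]_x f x| <= M.
Proof.
move=> bf fM; apply: (le_trans (le_normr_Rintegral _ (bm_integrable bf))) => //.
by rewrite -[leRHS]prob_int_cst; apply: bm_int_le => //;
  [exact: bm_norm | exact: bm_cst].
Qed.

Lemma bm_int_ae f g : bounded_meas f -> bounded_meas g ->
  {ae P, forall x, f x = g x} -> \int[P]_x f x = \int[P]_x g x.
Proof.
move=> [mf _] [mg _] fg; congr fine; apply: ae_eq_integral => //.
- exact/measurable_EFinP.
- exact/measurable_EFinP.
- by apply: filterS fg => x /= -> _.
Qed.

Lemma bm_int0_ae f : bounded_meas f -> (forall x, 0 <= f x) ->
  \int[P]_x f x = 0 -> {ae P, forall x, f x = 0}.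
Proof.
move=> bf f0 if0.
have : (\int[P]_x `|(f x)%:E|)%E = 0%E.
  under eq_integral do rewrite gee0_abs ?lee_fin//.
  by rewrite -bm_intE// if0.
move/(ae_eq_integral_abs P measurableT _).
case: bf => mf _; move=> /(_ (proj2 (measurable_EFinP _ _) mf)).
by apply: filterS => x /= /(_ I) [].
Qed.

Lemma bm_CS f g : bounded_meas f -> bounded_meas g ->
  (\int[P]_x (f x * g x)) ^+ 2 <=
  (\int[P]_x (f x ^+ 2)) * (\int[P]_x (g x ^+ 2)).
Proof.
move=> bf bg; set b := \int[P]_x (f x * g x).
set a := \int[P]_x (f x ^+ 2); set c := \int[P]_x (g x ^+ 2).
have quad u v : 0 <= u ^+ 2 * a + (2 * u * v * b + v ^+ 2 * c).
  have -> : u ^+ 2 * a + (2 * u * v * b + v ^+ 2 * c) =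
      \int[P]_x ((u * f x + v * g x) ^+ 2).
    rewrite -!bm_intZl; try by bm_tac.
    rewrite -!bm_intD; try by bm_tac.
    by apply: Rint_eq => x; ring.
  by apply: Rint_ge0 => x; exact: sqr_ge0.
have a0 : 0 <= a by apply: Rint_ge0 => x; exact: sqr_ge0.
have c0 : 0 <= c by apply: Rint_ge0 => x; exact: sqr_ge0.
have [c_eq0|c_neq0] := eqVneq c 0; last first.
  have cgt0 : 0 < c by rewrite lt_neqAle eq_sym c_neq0.
  have := quad c (- b).
  have -> : c ^+ 2 * a + (2 * c * - b * b + (- b) ^+ 2 * c) = c * (a * c - b ^+ 2).
    by ring.
  by rewrite pmulr_rge0// subr_ge0.
rewrite c_eq0 mulr0.
(* With c = 0 the form takes the value -(a + 2) b^2 at this point, so b must vanish. *)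
have := quad b (- (a + 1)); rewrite c_eq0 mulr0 addr0 => h.
have b2 := sqr_ge0 b.
nra.
Qed.

Lemma bm_dominated_cvg (F : nat -> X -> R) f M :
  (forall n, measurable_fun setT (F n)) -> (forall n x, `|F n x| <= M) ->
  (forall x, F n x @[n --> \oo] --> f x) ->
  bounded_meas f /\ \int[P]_x F n x @[n --> \oo] --> \int[P]_x f x.
Proof.
move=> mF FM Ff.
have mf : measurable_fun setT f.
  by apply: measurable_fun_cvg (mF) _ => x _; exact: Ff.
have bf : bounded_meas f.
  split=> //; exists M => x; have /(cvg_norm) h := Ff x.
  rewrite -(cvg_lim _ h)//; apply: limr_le; first by apply/cvg_ex; exists `|f x|.
  by near=> n; exact: FM.
split=> //.
have bF n : bounded_meas (F n) by split=> //; exists M.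
have [] := @dominated_convergence _ X R P setT measurableT (fun n x => (F n x)%:E)
  (fun x => (f x)%:E) (fun=> M%:E).
- by move=> n; apply/measurable_EFinP.
- exact/measurable_EFinP.
- by apply: aeW => x _; apply: cvg_EFin; [exact: nearW | exact: Ff].
- exact: finite_measure_integrable_cst.
- by apply: aeW => x n _; rewrite lee_fin.
move=> _ _; rewrite -bm_intE// => /fine_cvg.
apply: cvg_trans; apply: near_eq_cvg; near=> n => /=.
by [].
Unshelve. all: by end_near. Qed.

End BoundedInt.

Section BoundedFubini.
Context (R : realType) d (X : measurableType d) d' (Y : measurableType d').
Variables (P : probability X R) (Q : probability Y R).
Implicit Types f : X * Y -> R.

Lemma bm_section1 f x : bounded_meas f -> bounded_meas (fun y => f (x, y)).
Proof. by apply: bm_comp; exact: pair1_measurable. Qed.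

Lemma bm_section2 f y : bounded_meas f -> bounded_meas (fun x => f (x, y)).
Proof. by apply: bm_comp; exact: pair2_measurable. Qed.

Lemma bm_int f : bounded_meas f -> bounded_meas (fun x => \int[Q]_y f (x, y)).
Proof.
move=> bf; split; last first.
  have [_ [M fM]] := bf; exists M => x.
  by apply: bm_int_norm => //; exact: bm_section1.
apply/measurable_EFinP.
have := @measurable_fubini_F _ _ X Y R P Q _ (bm_integrable (P \x Q)%E bf).
apply: eq_measurable_fun => x _ /=.
by rewrite /fubini_F bm_intE//; exact: bm_section1.
Qed.

Lemma bm_fubini1 f : bounded_meas f ->
  \int[(P \x Q)%E]_z f z = \int[P]_x \int[Q]_y f (x, y).
Proof.
move=> bf; congr fine.
rewrite -(integral12_prod_meas1 (bm_integrable (P \x Q)%E bf)).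
apply: eq_integral => x _.
by rewrite /fubini_F bm_intE//; exact: bm_section1.
Qed.

Lemma bm_fubini2 f : bounded_meas f ->
  \int[(P \x Q)%E]_z f z = \int[Q]_y \int[P]_x f (x, y).
Proof.
move=> bf; congr fine.
rewrite -(integral21_prod_meas1 (bm_integrable (P \x Q)%E bf)).
apply: eq_integral => x _.
by rewrite /fubini_G bm_intE//; exact: bm_section2.
Qed.

Lemma bm_fubini f : bounded_meas f ->
  \int[P]_x \int[Q]_y f (x, y) = \int[Q]_y \int[P]_x f (x, y).
Proof. by move=> bf; rewrite -bm_fubini1// bm_fubini2. Qed.

End BoundedFubini.

Section AlmostEverywhere.
Context (R : realType) d (X : measurableType d) (P : probability X R).
Implicit Types A B C : X -> Prop.

Lemma prob_ae_imp A B : (forall x, A x -> B x) ->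
  {ae P, forall x, A x} -> {ae P, forall x, B x}.
Proof. by move=> AB; apply: filterS. Qed.

Lemma prob_ae_imp2 A B C : (forall x, A x -> B x -> C x) ->
  {ae P, forall x, A x} -> {ae P, forall x, B x} -> {ae P, forall x, C x}.
Proof. by move=> ABC; apply: filterS2. Qed.

End AlmostEverywhere.

(** * Existence of eigenvalues of symmetric kernels *)

Ltac meas_proj := repeat first
  [ exact: measurable_id | exact: measurable_cst | exact: measurable_fst
  | exact: measurable_snd | apply/measurable_fun_pair
  | apply: (measurableT_comp measurable_fst)
  | apply: (measurableT_comp measurable_snd) ].

Section Kernels.
Context (R : realType) d (T : measurableType d) (m : probability T R).
Implicit Types K L F G : T * T -> R.

Definition kcomp K L : T * T -> R :=
  fun z => \int[m]_u (K (z.1, u) * L (u, z.2)).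

(** The Hilbert-Schmidt inner product of the integral operators with these kernels. *)
Definition hsip K L : R := \int[(m \x m)%E]_z (K z * L z).

Lemma bm_kcomp K L : bounded_meas K -> bounded_meas L ->
  bounded_meas (kcomp K L).
Proof.
move=> bK bL; apply: (@bm_int R _ _ _ _ (m \x m)%E m
  (fun w : (T * T) * T => K (w.1.1, w.2) * L (w.2, w.1.2))).
apply: bmM.
- by apply: (bm_comp (h := fun w : (T * T) * T => (w.1.1, w.2))) => //; meas_proj.
- by apply: (bm_comp (h := fun w : (T * T) * T => (w.2, w.1.2))) => //; meas_proj.
Qed.

Lemma kcompA K L F : bounded_meas K -> bounded_meas L -> bounded_meas F ->
  kcomp (kcomp K L) F = kcomp K (kcomp L F).
Proof.
move=> bK bL bF; apply/funext => -[x y]; rewrite /kcomp /=.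
transitivity (\int[m]_u \int[m]_v (K (x, v) * L (v, u) * F (u, y))).
  apply: Rint_eq => u; rewrite -bm_intZr//.
  by apply: bmM; [exact: bm_section1|exact: bm_section2].
rewrite (@bm_fubini _ _ _ _ _ m m
  (fun w => K (x, w.2) * L (w.2, w.1) * F (w.1, y))).
  apply: Rint_eq => v /=; rewrite -bm_intZl.
    by apply: Rint_eq => u; rewrite mulrA.
  by apply: bmM; [exact: bm_section1|exact: bm_section2].
apply: bmM; first apply: bmM.
- by apply: (bm_comp (h := fun w : T * T => (x, w.2))) => //; meas_proj.
- by apply: (bm_comp (h := fun w : T * T => (w.2, w.1))) => //; meas_proj.
- by apply: (bm_comp (h := fun w : T * T => (w.1, y))) => //; meas_proj.
Qed.

Lemma kcomp_lin_l a b F G K : bounded_meas F -> bounded_meas G ->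
  bounded_meas K ->
  kcomp (fun z => a * F z - b * G z) K =
  (fun z => a * kcomp F K z - b * kcomp G K z).
Proof.
move=> bF bG bK; apply/funext => -[x y]; rewrite /kcomp /=.
have bFs : bounded_meas (fun u => F (x, u)) by exact: bm_section1.
have bGs : bounded_meas (fun u => G (x, u)) by exact: bm_section1.
have bKs : bounded_meas (fun u => K (u, y)) by exact: bm_section2.
rewrite -!bm_intZl; try by bm_tac.
rewrite -bm_intB; try by bm_tac.
by apply: Rint_eq => u; ring.
Qed.

Lemma kcomp_lin_r a b F G K : bounded_meas F -> bounded_meas G ->
  bounded_meas K ->
  kcomp K (fun z => a * F z - b * G z) =
  (fun z => a * kcomp K F z - b * kcomp K G z).
Proof.
move=> bF bG bK; apply/funext => -[x y]; rewrite /kcomp /=.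
have bFs : bounded_meas (fun u => F (u, y)) by exact: bm_section2.
have bGs : bounded_meas (fun u => G (u, y)) by exact: bm_section2.
have bKs : bounded_meas (fun u => K (x, u)) by exact: bm_section1.
rewrite -!bm_intZl; try by bm_tac.
rewrite -bm_intB; try by bm_tac.
by apply: Rint_eq => u; ring.
Qed.

(** Cauchy-Schwarz in the inner variable bounds the squared composition at (x, y) by a function of x
    times a function of y, and Fubini integrates this product to the two squared norms. *)
Lemma hs_kcomp_le K L : bounded_meas K -> bounded_meas L ->
  hsip (kcomp K L) (kcomp K L) <= hsip K K * hsip L L.
Proof.
move=> bK bL.
have bKL := bm_kcomp bK bL.
pose p x := \int[m]_u (K (x, u) ^+ 2).
pose q y := \int[m]_u (L (u, y) ^+ 2).
have bp : bounded_meas p.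
  by apply: (@bm_int _ _ _ _ _ m m (fun w => K w ^+ 2)); exact: bmX.
have bq : bounded_meas q.
  apply: (@bm_int _ _ _ _ _ m m (fun w => L (w.2, w.1) ^+ 2)); apply: bmX.
  by apply: (bm_comp (h := fun w : T * T => (w.2, w.1))) => //; meas_proj.
have -> : hsip K K * hsip L L = \int[(m \x m)%E]_z (p z.1 * q z.2).
  have -> : hsip K K = \int[m]_x p x.
    rewrite /hsip bm_fubini1; last exact: bmM.
    by do 2 apply: Rint_eq => ?; rewrite expr2.
  have -> : hsip L L = \int[m]_y q y.
    rewrite /hsip bm_fubini2; last exact: bmM.
    by do 2 apply: Rint_eq => ?; rewrite expr2.
  rewrite bm_fubini1; last first.
    by apply: bmM; [apply: bm_comp bp|apply: bm_comp bq].
  by rewrite -bm_intZr//; apply: Rint_eq => x /=; rewrite bm_intZl.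
apply: bm_int_le.
- exact: bmM.
- by apply: bmM; [apply: bm_comp bp|apply: bm_comp bq].
move=> [x y] /=; rewrite -expr2; apply: bm_CS.
- exact: bm_section1.
- exact: bm_section2.
Qed.

(** Two applications of Cauchy-Schwarz, one for each outer factor. A bound on [F] in L^2 thereby
    becomes a bound at every point, which upgrades L^2 convergence to uniform convergence. *)
Lemma kcomp_sandwich_le K F M x y : bounded_meas K -> bounded_meas F ->
  (forall z, `|K z| <= M) ->
  kcomp K (kcomp F K) (x, y) ^+ 2 <= M ^+ 4 * hsip F F.
Proof.
move=> bK bF KM.
have bFK := bm_kcomp bF bK.
have M0 : 0 <= M by exact: le_trans (normr_ge0 _) (KM (x, y)).
have KM2 z : K z ^+ 2 <= M ^+ 2.
  by rewrite -real_normK ?num_real// lerXn2r// ?nnegrE.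
apply: le_trans (bm_CS m (bm_section1 x bK) (bm_section2 y bFK)) _ => /=.
have -> : M ^+ 4 * hsip F F = M ^+ 2 * (M ^+ 2 * hsip F F) by ring.
apply: ler_pM.
- by apply: Rint_ge0 => u; exact: sqr_ge0.
- by apply: Rint_ge0 => u; exact: sqr_ge0.
- rewrite -[leRHS](prob_int_cst m); apply: bm_int_le => //.
  + by apply: bmX; exact: bm_section1.
  + exact: bm_cst.
- rewrite /hsip bm_fubini1; last exact: bmM.
  rewrite -bm_intZl; last first.
    by apply: (@bm_int _ _ _ _ _ m m (fun w => F w * F w)); exact: bmM.
  apply: bm_int_le.
  + by apply: bmX; exact: bm_section2.
  + apply: bmM; first exact: bm_cst.
    by apply: (@bm_int _ _ _ _ _ m m (fun w => F w * F w)); exact: bmM.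
  move=> u; rewrite mulrC.
  apply: le_trans (bm_CS m (bm_section1 u bF) (bm_section2 y bK)) _ => /=.
  apply: ler_pM.
  + by apply: Rint_ge0 => v; exact: sqr_ge0.
  + by apply: Rint_ge0 => v; exact: sqr_ge0.
  + by under Rint_eq do rewrite expr2.
  + rewrite -[leRHS](prob_int_cst m); apply: bm_int_le => //.
    * by apply: bmX; exact: bm_section2.
    * exact: bm_cst.
Qed.

End Kernels.

Section Iterates.
Context (R : realType) d (T : measurableType d) (m : probability T R).
Variable K : T * T -> R.
Hypothesis bK : bounded_meas K.
Hypothesis symK : forall x y, K (x, y) = K (y, x).

(* [kiter n] is the (n+1)-st operator power of K. *)
Fixpoint kiter n : T * T -> R := if n is n'.+1 then kcomp m K (kiter n') else K.

Lemma bm_kiter n : bounded_meas (kiter n).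
Proof. by elim: n => //= n ih; exact: bm_kcomp. Qed.

Lemma kcomp_kiter i j : kcomp m (kiter i) (kiter j) = kiter (i + j).+1.
Proof.
by elim: i => //= i ih; rewrite kcompA ?ih//; exact: bm_kiter.
Qed.

Lemma kiter_sym n x y : kiter n (x, y) = kiter n (y, x).
Proof.
elim: n x y => //= n ih x y.
(* On the right the factor [K] is split off at the other end of the power, so that the two
   integrands are reversals of each other. *)
rewrite -[RHS]/(kiter n.+1 (y, x)) -[n in RHS]addn0 -kcomp_kiter /kcomp /=.
by apply: Rint_eq => u; rewrite mulrC ih symK.
Qed.

Let tr k := \int[m]_x kiter k (x, x).

(** For symmetric kernels the inner product is the trace of the product, so between powers of [K] it
    depends on the sum of the exponents alone. *)
Lemma hsip_kiter i j : hsip m (kiter i) (kiter j) = tr (i + j).+1.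
Proof.
rewrite /hsip bm_fubini1; last by apply: bmM; exact: bm_kiter.
rewrite /tr -kcomp_kiter; apply: Rint_eq => x.
by apply: Rint_eq => y /=; rewrite [kiter j (x, y)]kiter_sym.
Qed.

Let a n := hsip m (kiter n) (kiter n).

(** Since n + (n + 2) = 2 (n + 1), the middle term is also the inner product of [kiter n] with
    [kiter n.+2], and Cauchy-Schwarz applies. *)
Lemma hs_kiter_logconvex n : a n.+1 ^+ 2 <= a n * a n.+2.
Proof.
have -> : a n.+1 = hsip m (kiter n) (kiter n.+2).
  by rewrite /a !hsip_kiter !addnS addSn.
rewrite /a {2 3}/hsip.
under Rint_eq do rewrite -expr2.
under [X in _ <= _ * X]Rint_eq do rewrite -expr2.
by apply: bm_CS; exact: bm_kiter.
Qed.

Lemma hs_kiter_submul i j : a (i + j).+1 <= a i * a j.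
Proof. by rewrite /a -kcomp_kiter; apply: hs_kcomp_le; exact: bm_kiter. Qed.

End Iterates.

Lemma cauchy_seq_cvg (R : realType) (u : nat -> R) :
  (forall e : R, 0 < e -> exists N, forall n, (N <= n)%N -> `|u N - u n| < e) ->
  cvgn u.
Proof.
move=> cu; apply/cauchy_cvgP/cauchy_exP => e e0.
have [N uN] := cu _ e0; exists (u N).
by exists N => // n /= Nn; exact: uN.
Qed.

Lemma cvgn_succ (R : realType) (u : nat -> R) (l : R) :
  u n @[n --> \oo] --> l -> u n.+1 @[n --> \oo] --> l.
Proof. by move=> ul; rewrite (cvg_shiftS u). Qed.

(* Schmidt's argument. The squared Hilbert-Schmidt norm a n of the (n+1)-st power
   of K is log-convex and submultiplicative, so the ratios b n increase to some
   c > 0 and a n >= c^(n+1). Then F n, the (2n+1)-st power divided by c^n, is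
   Cauchy in L^2; composing with K on both sides makes the convergence uniform,
   and the limit satisfies K K P = c P with <P, F 0> >= c. *)
Section Schmidt.
Context (R : realType) d (T : measurableType d) (m : probability T R).
Variable K : T * T -> R.
Hypothesis bK : bounded_meas K.
Hypothesis symK : forall x y, K (x, y) = K (y, x).

Let kit := kiter m K.
Let bkit n : bounded_meas (kit n) := bm_kiter m bK n.
Let a n := hsip m (kit n) (kit n).

Hypothesis a0_gt0 : 0 < a 0%N.
Hypothesis a1_gt0 : 0 < a 1%N.

Let a_gt0 n : 0 < a n.
Proof.
suff /andP[] : (0 < a n) && (0 < a n.+1) by [].
elim: n => [|n /andP[an an1]]; first by rewrite a0_gt0 a1_gt0.
rewrite an1 /=.
have := hs_kiter_logconvex m bK symK n; rewrite -/(a _) -/(a _) -/(a _).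
by rewrite -(pmulr_rgt0 _ an); apply: lt_le_trans; rewrite exprn_gt0.
Qed.

Let b n := a n.+1 / a n.

Let b_gt0 n : 0 < b n. Proof. by rewrite divr_gt0. Qed.

Let b_nd : nondecreasing_seq b.
Proof.
apply/nondecreasing_seqP => n; rewrite /b ler_pdivrMr// mulrAC ler_pdivlMr//.
by rewrite -expr2 mulrC; exact: hs_kiter_logconvex.
Qed.

Let b_le n : b n <= a 0%N.
Proof.
rewrite /b ler_pdivrMr// mulrC.
by have := hs_kiter_submul m bK n 0; rewrite addn0.
Qed.

Let b_cvg : cvgn b.
Proof.
by apply: nondecreasing_is_cvgn => //; exists (a 0%N) => _ [n _ <-].
Qed.

Let c := limn b.

Let b_le_c n : b n <= c. Proof. exact: nondecreasing_cvgn_le. Qed.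

Let c_gt0 : 0 < c. Proof. exact: lt_le_trans (b_gt0 0) (b_le_c 0). Qed.

Let a_pow i j : a i * b i ^+ j <= a (i + j)%N.
Proof.
elim: j => [|j ih]; first by rewrite expr0 mulr1 addn0.
rewrite exprSr mulrA addnS.
have -> : a (i + j).+1 = a (i + j)%N * b (i + j)%N.
  by rewrite /b mulrC divfK// gt_eqF.
apply: ler_pM => //; last exact: b_nd (leq_addr _ _).
- by rewrite mulr_ge0 ?exprn_ge0 ?ltW.
- exact: ltW.
Qed.

(** For each i, a_i b_i^(n+1) <= a_(i+n+1) <= a_i a_n by [a_pow] and submultiplicativity. Cancelling
    a_i and letting i tend to infinity gives the bound. *)
Let c_pow_le n : c ^+ n.+1 <= a n.
Proof.
have bX : b k ^+ n.+1 @[k --> \oo] --> c ^+ n.+1.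
  exact: (cvg_comp _ _ b_cvg (@exprn_continuous R n.+1 c)).
rewrite -(cvg_lim _ bX)//; apply: limr_le; first by apply/cvg_ex; exists (c ^+ n.+1).
near=> i; rewrite -(ler_pM2l (a_gt0 i)) (le_trans (a_pow _ _))// addnS.
exact: hs_kiter_submul.
Unshelve. all: by end_near. Qed.

(** The Gram matrix of the sequence [F] below has entries e (i + j). This sequence decreases because
    the ratios [b n] stay below [c], and it is bounded below by [c]. Its convergence makes [F]
    Cauchy, and its positive lower bound keeps the limit of [F] from vanishing. *)
Let e n := a n / c ^+ n.

Let e_ge n : c <= e n.
Proof. by rewrite ler_pdivlMr ?exprn_gt0// -exprS. Qed.

Let e_ni : nonincreasing_seq e.
Proof.
apply/nonincreasing_seqP => n; rewrite /e ler_pdivrMr ?exprn_gt0//.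
rewrite exprSr mulrA divfK ?gt_eqF ?exprn_gt0//.
by rewrite -ler_pdivrMl// mulrC; exact: b_le_c.
Qed.

Let e_cvg : cvgn e.
Proof.
by apply: nonincreasing_is_cvgn => //; exists c => _ [n _ <-].
Qed.

Let F n : T * T -> R := fun z => (c ^+ n)^-1 * kit n.*2 z.

Let bF n : bounded_meas (F n).
Proof. by apply: bmM => //; exact: bm_cst. Qed.

Let ipF i j : hsip m (F i) (F j) = e (i + j)%N.
Proof.
transitivity ((c ^+ i)^-1 * ((c ^+ j)^-1 * hsip m (kit i.*2) (kit j.*2))).
  rewrite /hsip -!bm_intZl; try by bm_tac.
  by apply: Rint_eq => z; rewrite /F; ring.
rewrite /e /a !hsip_kiter// exprD invfM -doubleD -addnn.
by rewrite [RHS]mulrC -mulrA.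
Qed.

Let ipFB i j :
  hsip m (fun z => F i z - F j z) (fun z => F i z - F j z) =
  e (i + i)%N - 2 * e (i + j)%N + e (j + j)%N.
Proof.
rewrite -!ipF /hsip -!bm_intZl; try by bm_tac.
rewrite -bm_intB; try by bm_tac.
rewrite -bm_intD; try by bm_tac.
by apply: Rint_eq => z; ring.
Qed.

Let FS n z : F n.+1 z = c^-1 * kcomp m K (kcomp m (F n) K) z.
Proof.
have -> : F n = fun z => (c ^+ n)^-1 * kit n.*2 z - 0 * kit n.*2 z.
  by apply/funext => w; rewrite mul0r subr0.
rewrite kcomp_lin_l// kcomp_lin_r//; try exact: bm_kcomp.
rewrite mul0r subr0 mulrA /F exprS invfM doubleS; congr (_ * _).
rewrite -[K in kcomp m (kit _) K]/(kit 0%N) -[in RHS]/(kit n.*2).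
by rewrite kcomp_kiter// addn0.
Qed.

Lemma schmidt : exists c' : R, exists f : T -> R,
  [/\ 0 < c', bounded_meas f,
      forall x, \int[m]_u (K (x, u) * \int[m]_v (K (u, v) * f v)) = c' * f x &
      ~ {ae m, forall x, f x = 0}].
Proof.
have [M KM] := bK.2.
have M0 : 0 <= M by exact: le_trans (normr_ge0 _) (KM point).
have FB i j z : (F i.+1 z - F j.+1 z) ^+ 2 <=
    c ^- 2 * (M ^+ 4 * (e (i + i)%N - 2 * e (i + j)%N + e (j + j)%N)).
  rewrite !FS -mulrBr exprMn exprVn ler_pM2l ?invr_gt0 ?exprn_gt0//.
  rewrite -ipFB.
  have -> : kcomp m K (kcomp m (F i) K) z - kcomp m K (kcomp m (F j) K) z =
      kcomp m K (kcomp m (fun z => F i z - F j z) K) z.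
    have -> : (fun z => F i z - F j z) = (fun z => 1 * F i z - 1 * F j z).
      by apply/funext => w; rewrite !mul1r.
    rewrite kcomp_lin_l// kcomp_lin_r//; try exact: bm_kcomp.
    by rewrite !mul1r.
  by case: z => x y; apply: kcomp_sandwich_le => //; exact: bmB.
have Fcvg z : cvgn (fun n => F n.+1 z).
  apply: cauchy_seq_cvg => eps eps0.
  (* If three values of [e] are within [del] of the limit, their second difference is at most 4
     [del], and [FB] then gives a square below eps^2. The summand 1 keeps the denominator positive
     and the final inequality strict. *)
  pose del := eps ^+ 2 * c ^+ 2 / (M ^+ 4 + 1) / 4.
  have del0 : 0 < del by rewrite !divr_gt0 ?mulr_gt0 ?exprn_gt0// ltr_wpDl ?exprn_ge0.
  have /cvgrPdist_lt/(_ _ del0)[N _ eN] : e n @[n --> \oo] --> limn e by [].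
  exists N => n Nn.
  rewrite -(ltr_pXn2r (n := 2))// ?nnegrE// ?ltW// real_normK ?num_real//.
  apply: le_lt_trans (FB _ _ _) _.
  rewrite ltr_pdivrMl ?exprn_gt0//.
  have h1 : e (N + N)%N - 2 * e (N + n)%N + e (n + n)%N <= 4 * del.
    have := eN (N + N)%N (leq_addr _ _); have := eN (N + n)%N (leq_addr _ _).
    have := eN (n + n)%N (leq_trans Nn (leq_addr _ _)).
    by rewrite /= !ltr_distl => /andP[? ?] /andP[? ?] /andP[? ?]; lra.
  apply: (@le_lt_trans _ _ (M ^+ 4 * (4 * del))).
    by rewrite ler_wpM2l// exprn_ge0.
  have -> : 4 * del = eps ^+ 2 * c ^+ 2 / (M ^+ 4 + 1) by rewrite /del; field;
     rewrite gt_eqF// ltr_wpDl// exprn_ge0.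
  rewrite mulrA ltr_pdivrMr ?ltr_wpDl ?exprn_ge0// mulrC [c ^+ 2 * _]mulrC.
  by rewrite ltr_pM2l ?mulr_gt0 ?exprn_gt0// ltrDl.
have Fbound : exists M', forall n z, `|F n.+1 z| <= M'.
  exists (Num.sqrt (c ^- 2 * (M ^+ 4 * e 0%N))) => n z.
  rewrite -sqrtr_sqr ler_wsqrtr//.
  apply: (@le_trans _ _ (c ^- 2 * (M ^+ 4 * hsip m (F n) (F n)))).
    rewrite FS exprMn exprVn ler_pM2l ?invr_gt0 ?exprn_gt0//.
    by case: z => x y; exact: kcomp_sandwich_le.
  rewrite ipF; apply: ler_wpM2l; first by rewrite invr_ge0 exprn_ge0// ltW.
  by apply: ler_wpM2l; [exact: exprn_ge0 | exact: e_ni].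
have [M' FM'] := Fbound.
pose P z := limn (fun n => F n.+1 z).
have FP z : F n.+1 z @[n --> \oo] --> P z by exact: Fcvg.
have bP : bounded_meas P.
  have [] // := @bm_dominated_cvg _ _ _ (m \x m)%E (fun n => F n.+1) P M' _ FM' FP.
  by move=> n; case: (bF n.+1).
have eigP x y : \int[m]_u (K (x, u) * \int[m]_v (K (u, v) * P (v, y))) = c * P (x, y).
  have -> : \int[m]_u (K (x, u) * \int[m]_v (K (u, v) * P (v, y))) =
     kcomp m (kcomp m K K) P (x, y) by rewrite kcompA.
  have bKK := bm_kcomp m bK bK.
  have [M2 KKM2] := bKK.2.
  have [_ h] : bounded_meas (fun u => kcomp m K K (x, u) * P (u, y)) /\
    \int[m]_u (kcomp m K K (x, u) * F n.+1 (u, y)) @[n --> \oo] -->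
    \int[m]_u (kcomp m K K (x, u) * P (u, y)).
    apply: (@bm_dominated_cvg _ _ _ _ _ _ (M2 * M')).
    - by move=> n; apply: (bmM _ _).1; [exact: bm_section1|exact: bm_section2].
    - by move=> n u; rewrite normrM ler_pM.
    - by move=> u; apply: cvgMl_tmp; exact: FP.
  apply: (cvg_unique _ h) => //=.
  have -> : (fun n => \int[m]_u (kcomp m K K (x, u) * F n.+1 (u, y))) =
      (fun n => c * F n.+2 (x, y)).
    apply/funext => n; rewrite FS mulrA divff ?gt_eqF// mul1r.
    (* [F] consists of multiples of powers of [K], which commute with [K]; hence K F K = K K F, and
       the recursion [FS] becomes the eigenvalue equation in the limit. *)
    have kF : kcomp m (F n.+1) K = kcomp m K (F n.+1).
      have -> : F n.+1 = fun z => (c ^+ n.+1)^-1 * kit n.+1.*2 z - 0 * kit n.+1.*2 z.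
        by apply/funext => w; rewrite mul0r subr0.
      rewrite kcomp_lin_l// kcomp_lin_r//.
      have -> : kcomp m K (kit n.+1.*2) = kcomp m (kit n.+1.*2) K.
        by rewrite (kcomp_kiter m bK 0) -[LHS]/(kit _) (kcomp_kiter m bK _ 0) addn0.
      by [].
    by rewrite kF -kcompA.
  apply: cvgMl_tmp.
  exact: cvgn_succ (FP (x, y)).
have ipP : hsip m P (F 0%N) = limn e.
  have [MF0 F0M] := (bF 0%N).2.
  have [_ h] : bounded_meas (fun z => P z * F 0%N z) /\
    \int[(m \x m)%E]_z (F n.+1 z * F 0%N z) @[n --> \oo] -->
    \int[(m \x m)%E]_z (P z * F 0%N z).
    apply: (@bm_dominated_cvg _ _ _ _ _ _ (M' * MF0)).
    - by move=> n; apply: (bmM _ _).1.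
    - by move=> n u; rewrite normrM ler_pM.
    - by move=> u; apply: cvgMr_tmp; exact: FP.
  apply: (cvg_unique _ h) => //=.
  have -> : (fun n => \int[(m \x m)%E]_z (F n.+1 z * F 0%N z)) = (fun n => e n.+1).
    by apply/funext => n; rewrite -[LHS]/(hsip m _ _) ipF addn0.
  exact: cvgn_succ e_cvg.
(* A column of [P] serves as eigenfunction. If all columns vanished a.e., Fubini would give <P, F 0>
   = 0, against <P, F 0> = lim e >= c > 0. *)
have [y Py] : exists y, ~ {ae m, forall x, P (x, y) = 0}.
  apply: contrapT => /forallNP Pae.
  have : hsip m P (F 0%N) = 0.
    rewrite /hsip bm_fubini2; last exact: bmM.
    rewrite -[RHS](prob_int_cst m); apply: Rint_eq => y.
    rewrite -[RHS](prob_int_cst m); apply: bm_int_ae.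
    - by apply: bmM; exact: bm_section2.
    - exact: bm_cst.
    - by have /contrapT := Pae y; apply: filterS => x ->; rewrite mul0r.
  rewrite ipP => lime0; suff : 0 < limn e by rewrite lime0 ltxx.
  apply: (lt_le_trans c_gt0); apply: limr_ge => //.
  by near=> n; exact: e_ge.
exists c, (fun x => P (x, y)); split.
- exact: c_gt0.
- exact: bm_section2.
- by move=> x; exact: eigP.
- exact: Py.
Unshelve. all: by end_near. Qed.

End Schmidt.

(** * Kernels without non-zero eigenvalues vanish *)

Section Separation.
Context (R : realType) d (T : measurableType d) (m : probability T R).
Variable K : T * T -> R.
Hypothesis bK : bounded_meas K.

(** Rectangles form a pi-system generating the product sigma-algebra, so Dynkin's theorem extends
    the vanishing to all measurable sets. Testing on the set where [K] is positive and on its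
    complement gives that |K| has integral 0. *)
Lemma kernel_ae0_rect :
  (forall A B, measurable A -> measurable B -> hsip m K \1_(A `*` B) = 0) ->
  {ae (m \x m)%E, forall z, K z = 0}.
Proof.
move=> Krect.
have bKS (S : set (T * T)) : measurable S -> bounded_meas (fun z => K z * \1_S z).
  by move=> mS; apply: bmM => //; exact: bm_indic.
have Kset (S : set (T * T)) : measurable S -> hsip m K \1_S = 0.
  rewrite measurable_prod_measurableType; 
  apply: (@dynkin_induction _ _ _ (fun S => hsip m K \1_S = 0)).
  - by rewrite measurable_prod_measurableType.
  - move=> _ _ [A1 mA1 [A2 mA2 <-]] [B1 mB1 [B2 mB2 <-]].
    exists (A1 `&` B1); first exact: measurableI.
    by exists (A2 `&` B2); [exact: measurableI | rewrite setXI].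
  - by have := Krect _ _ measurableT measurableT; rewrite setXTT.
  - by move=> _ [A mA [B mB <-]]; exact: Krect.
  - move=> E mE KE0.
    have KT0 : hsip m K (\1_[set: T * T]) = 0.
      by have := Krect _ _ measurableT measurableT; rewrite setXTT.
    transitivity (hsip m K \1_[set: T * T] - hsip m K \1_E).
      rewrite /hsip -bm_intB; [|exact: bKS|exact: bKS].
      apply: Rint_eq => z; rewrite !indicE in_setC in_setT.
      by case: (z \in E) => /=; ring.
    by rewrite KT0 KE0 subrr.
  - move=> F mF tF KF0.
    (* The sets are disjoint, so these partial sums stay in [0,1] and dominated convergence handles
       the countable union. *)
    pose g n z : R := \sum_(k < n) \1_(F k) z.
    have gF z : g n z @[n --> \oo] --> (\1_(\bigcup_k F k) z : R).
      have [[k _ Fkz]|nF] := pselect ((\bigcup_k F k) z).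
        rewrite indicE mem_set; last by exists k.
        apply: cvg_near_cst; exists k.+1 => // n /= kn.
        rewrite /g (bigD1 (Ordinal kn))//= indicE mem_set// big1 ?addr0// => i ik.
        rewrite indicE memNset// => Fiz.
        have := tF i k I I (ex_intro _ z (conj Fiz Fkz)) => ik'.
        by move: ik; rewrite -(inj_eq val_inj) /= ik' eqxx.
      rewrite indicE memNset//; apply: cvg_near_cst; exists 0%N => // n _.
      rewrite /g big1// => i _; rewrite indicE memNset// => Fiz.
      by apply: nF; exists i.
    have g1 n z : `|g n z| <= 1.
      rewrite ger0_norm; last by rewrite sumr_ge0// => i _; rewrite indicE ler0n.
      elim: n => [|n ih]; first by rewrite /g big_ord0 ler01.
      rewrite /g big_ord_recr/= [X in _ + X]indicE.
      have [/set_mem Fnz|] := boolP (z \in F n); last by rewrite addr0.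
      rewrite big1 ?add0r// => i _; rewrite indicE memNset// => Fiz.
      have := tF i n I I (ex_intro _ z (conj Fiz Fnz)) => ik'.
      by have := ltn_ord i; rewrite ik' ltnn.
    have bg n : bounded_meas (fun z => K z * g n z).
      by apply: bmM => //; apply: bm_sum => i _; apply: bm_indic.
    have [M KM] := bK.2.
    have [_ h] : bounded_meas (fun z => K z * \1_(\bigcup_k F k) z) /\
        \int[(m \x m)%E]_z (K z * g n z) @[n --> \oo] -->
        \int[(m \x m)%E]_z (K z * \1_(\bigcup_k F k) z).
      apply: (@bm_dominated_cvg _ _ _ _ _ _ (M * 1)).
      - by move=> n; case: (bg n).
      - by move=> n z; rewrite normrM ler_pM.
      - by move=> z; apply: cvgMl_tmp; exact: gF.
    have g0 n : \int[(m \x m)%E]_z (K z * g n z) = 0.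
      elim: n => [|n ih].
        rewrite -[RHS](prob_int_cst (m \x m)%E); apply: Rint_eq => z.
        by rewrite /g big_ord0 mulr0.
      transitivity (\int[(m \x m)%E]_z (K z * g n z) + hsip m K \1_(F n)).
        rewrite /hsip -bm_intD; [|exact: bg|exact: bKS].
        by apply: Rint_eq => z; rewrite /g big_ord_recr/= mulrDr.
      by rewrite ih KF0 addr0.
    apply: (cvg_unique _ h) => //=; under eq_fun do rewrite g0.
    exact: cvg_cst.
pose A := [set z | 0 < K z].
have mA : measurable A.
  have := measurable_fun_ltr (measurable_cst (0 : R)) bK.1.
  by move=> /(_ measurableT [set true] I); rewrite setTI.
have nK0 : \int[(m \x m)%E]_z `|K z| = 0.
  transitivity (hsip m K \1_A - hsip m K \1_(~` A)).
    rewrite /hsip -bm_intB; [|exact: bKS|by apply: bKS; exact: measurableC].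
    apply: Rint_eq => z; rewrite !indicE in_setC.
    have [/set_mem/= Kz|/negP Kz] := boolP (z \in A).
      by rewrite mulr1 mulr0 subr0 gtr0_norm.
    rewrite mulr1 mulr0 sub0r ler0_norm// leNgt; apply/negP => Kz'.
    by apply: Kz; rewrite inE.
  by rewrite !Kset ?subrr//; exact: measurableC.
have := bm_int0_ae (bm_norm bK) (fun z => normr_ge0 (K z)) nK0.
by apply: filterS => z /normr0P/eqP.
Qed.

Hypothesis symK : forall x y, K (x, y) = K (y, x).

Lemma hsip_kcomp_adj F G : bounded_meas F -> bounded_meas G ->
  hsip m (kcomp m K F) G = hsip m F (kcomp m K G).
Proof.
move=> bF bG; have bKF := bm_kcomp m bK bF; have bKG := bm_kcomp m bK bG.
rewrite /hsip bm_fubini2; last exact: bmM.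
rewrite bm_fubini2; last exact: bmM.
apply: Rint_eq => y; rewrite /kcomp /=.
transitivity (\int[m]_x \int[m]_u (K (x, u) * F (u, y) * G (x, y))).
  apply: Rint_eq => x; rewrite -bm_intZr//.
  by apply: bmM; [exact: bm_section1|exact: bm_section2].
rewrite (@bm_fubini _ _ _ _ _ m m (fun w => K w * F (w.2, y) * G (w.1, y))).
  apply: Rint_eq => u /=; rewrite -bm_intZl.
    by apply: Rint_eq => x; rewrite symK; ring.
  by apply: bmM; [exact: bm_section1|exact: bm_section2].
apply: bmM; first apply: bmM => //.
- by apply: (bm_comp (h := fun w : T * T => (w.2, y))) => //; meas_proj.
- by apply: (bm_comp (h := fun w : T * T => (w.1, y))) => //; meas_proj.
Qed.

Lemma hsip_CS F G : bounded_meas F -> bounded_meas G ->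
  hsip m F G ^+ 2 <= hsip m F F * hsip m G G.
Proof.
move=> bF bG; rewrite {2 3}/hsip.
under Rint_eq do rewrite -expr2.
under [X in _ <= _ * X]Rint_eq do rewrite -expr2.
exact: bm_CS.
Qed.

Lemma hsip_ge0 F : 0 <= hsip m F F.
Proof. by apply: Rint_ge0 => z; rewrite -expr2 sqr_ge0. Qed.

(** By self-adjointness the squared norm of K F is <F, K K F>, which is 0 by Cauchy-Schwarz. This
    settles the case in which the hypothesis [a1_gt0] of Schmidt's argument fails. *)
Lemma kcomp_self_eq0 : hsip m (kcomp m K K) (kcomp m K K) = 0 ->
  {ae (m \x m)%E, forall z, K z = 0}.
Proof.
move=> K2_0; apply: kernel_ae0_rect => A B mA mB.
have bKK := bm_kcomp m bK bK.
have KF0 F : bounded_meas F -> hsip m (kcomp m K F) (kcomp m K F) = 0.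
  move=> bF; have bKF := bm_kcomp m bK bF.
  rewrite hsip_kcomp_adj// -kcompA//.
  have bKKF := bm_kcomp m bKK bF.
  apply/eqP; rewrite -sqrf_eq0; apply/eqP/le_anti; rewrite sqr_ge0 andbT.
  apply: le_trans (hsip_CS bF bKKF) _.
  rewrite mulr_ge0_le0 ?hsip_ge0//.
  by rewrite (le_trans (hs_kcomp_le _ _ _))// K2_0 mul0r.
(* Functions of one variable are regarded as kernels constant in the second one; then <K F, G> is
   the integral of [K] over the rectangle. *)
pose F (z : T * T) : R := \1_B z.1; pose G (z : T * T) : R := \1_A z.1.
have bF : bounded_meas F by apply: bm_comp (bm_indic _ mB).
have bG : bounded_meas G by apply: bm_comp (bm_indic _ mA).
have : hsip m (kcomp m K F) G = 0.
  apply/eqP; rewrite -sqrf_eq0; apply/eqP/le_anti; rewrite sqr_ge0 andbT.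
  apply: le_trans (hsip_CS (bm_kcomp m bK bF) bG) _.
  by rewrite KF0// mul0r.
move=> <-; rewrite /hsip bm_fubini1; last first.
  by apply: bmM => //; apply: bm_indic; exact: measurableX.
rewrite bm_fubini2; last by apply: bmM => //; exact: bm_kcomp.
rewrite -[LHS](prob_int_cst m); apply: Rint_eq => y.
apply: Rint_eq => x; rewrite /G /= /kcomp /= -bm_intZr; last first.
  apply: bmM; first exact: bm_section1.
  by apply: bm_comp bF; exact: pair2_measurable.
apply: Rint_eq => u; rewrite /F /= !indicE in_setX /=.
by case: (x \in A); case: (u \in B); rewrite /=; ring.
Qed.

(* If K^2 f = l^2 f, then K f + l f is an eigenfunction for l unless it vanishes,
   in which case f is an eigenfunction for -l. *)
Lemma kernel_no_eigen_ae0 :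
  (forall l f, l != 0 -> bounded_meas f ->
     {ae m, forall x, \int[m]_u (K (x, u) * f u) = l * f x} ->
     {ae m, forall x, f x = 0}) ->
  {ae (m \x m)%E, forall z, K z = 0}.
Proof.
move=> noeig.
have bKK := bm_kcomp m bK bK.
have := hsip_ge0 (kcomp m K K).
rewrite le_eqVlt => /predU1P[/esym|K2_gt0]; first exact: kcomp_self_eq0.
have K_gt0 : 0 < hsip m K K.
  rewrite lt_neqAle hsip_ge0 andbT eq_sym; apply: contraTneq K2_gt0 => K0.
  by rewrite -leNgt (le_trans (hs_kcomp_le _ _ _))// K0 mul0r.
have [c [f [c_gt0 bf eigf fn0]]] := schmidt bK symK K_gt0 K2_gt0.
pose l := Num.sqrt c.
have l_gt0 : 0 < l by rewrite sqrtr_gt0.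
have ll : l * l = c by rewrite -expr2 sqr_sqrtr// ltW.
pose Kf x := \int[m]_u (K (x, u) * f u).
have bKf : bounded_meas Kf.
  apply: (@bm_int _ _ _ _ _ m m (fun w => K w * f w.2)).
  by apply: bmM => //; apply: bm_comp bf; exact: measurable_snd.
pose g x := Kf x + l * f x.
have bg : bounded_meas g by apply: bmD => //; apply: bmM => //; exact: bm_cst.
have g0 : {ae m, forall x, g x = 0}.
  apply: (noeig l) => //; first by rewrite gt_eqF.
  apply: aeW => x.
  transitivity (\int[m]_u (K (x, u) * Kf u + l * (K (x, u) * f u))).
    by apply: Rint_eq => u; rewrite /g; ring.
  have bKx : bounded_meas (fun u => K (x, u)) by exact: bm_section1.
  rewrite bm_intD; [|exact: bmM|by apply: bmM; [exact: bm_cst|exact: bmM]].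
  rewrite bm_intZl; last exact: bmM.
  by rewrite eigf -ll -/(Kf x) /g; ring.
exfalso; apply: fn0; apply: (noeig (- l)) => //; first by rewrite oppr_eq0 gt_eqF.
by apply: filterS g0 => x /eqP; rewrite addr_eq0 mulNr => /eqP.
Qed.

End Separation.

(** * Rigidity of the extremal equations *)

(* a is the measure of the set where W W_3 > 0, w the integral of W_2, r its
   integral over that set, and s^2 = 3 t. *)
Lemma extremal_arith (R : realType) (a r s t w : R) :
  0 < s -> s ^+ 2 = 3 * t -> 0 <= a -> a < 1 -> s <= 1 ->
  w = s * (1 - a) + r -> a ^+ 2 <= w -> r ^+ 2 <= a * (s ^+ 2 * a - 2 * t) ->
  0 <= s ^+ 2 * a - 2 * t -> False.
Proof.
move=> s0 st a0 a1 s1 -> aw r2 h0.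
have ht : 2 * t = s ^+ 2 * (2 / 3) by rewrite st; field.
have ha : 2 / 3 <= a.
  by move: h0; rewrite ht -mulrBr pmulr_rge0 ?exprn_gt0// subr_ge0.
have r2' : r ^+ 2 <= a * (a - 2 / 3).
  apply: le_trans r2 _; rewrite ht -mulrBr mulrCA ler_piMl//.
    by rewrite mulr_ge0// subr_ge0.
  by rewrite expr_le1// ltW.
(* From a^2 <= w and s <= 1. The left side is at least 1/9 because a >= 2/3, so the inequality may
   be squared. *)
have rl : a ^+ 2 + a - 1 <= r by nra.
have rp : 0 < a ^+ 2 + a - 1 by nra.
have : (a ^+ 2 + a - 1) ^+ 2 <= r ^+ 2.
  by rewrite ler_pXn2r// nnegrE ltW// (lt_le_trans rp).
move/le_trans => /(_ _ r2').
have pos : 0 < (a ^+ 2 + a - 1) ^+ 2 - a * (a - 2 / 3).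
  (* The number 7/6 is close to the value of a^2 + a at the minimum of the quartic. The remaining
     quadratic equals (2/3) (a - 2/3) (5/6 - a) + 1/108, hence is positive up to a = 5/6; beyond
     that point the quartic is far from 0. *)
  have -> : (a ^+ 2 + a - 1) ^+ 2 - a * (a - 2 / 3) =
     (a ^+ 2 + a - 7 / 6) ^+ 2 + (- (2 / 3) * a ^+ 2 + a - 13 / 36) by field.
  have [a4|a4] := leP a (5 / 6).
    have : 0 <= (a - 2 / 3) * (5 / 6 - a) by rewrite mulr_ge0// subr_ge0.
    have := sqr_ge0 (a ^+ 2 + a - 7 / 6).
    nra.
  have : 0 <= (a - 5 / 6) * (1 - a) by rewrite mulr_ge0// subr_ge0 ltW.
  nra.
by move: pos; rewrite subr_gt0 ltNge => /negP.
Qed.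

Section GraphonRigidity.
Context (R : realType) d (T : measurableType d) (m : probability T R).
Variable W : T * T -> R.
Hypothesis bW : bounded_meas W.
Hypothesis symW : forall x y, W (x, y) = W (y, x).
Hypothesis W01 : forall z, 0 <= W z <= 1.

Let W2 := kcomp m W W.
Let W3 := kcomp m W W2.
Let t := hsip m W2 W2.

Let bW2 : bounded_meas W2. Proof. exact: bm_kcomp. Qed.
Let bW3 : bounded_meas W3. Proof. exact: bm_kcomp. Qed.

Let W2_01 z : 0 <= W2 z <= 1.
Proof.
have bs : bounded_meas (fun u => W (z.1, u) * W (u, z.2)).
  by apply: bmM; [exact: bm_section1|exact: bm_section2].
apply/andP; split.
  by apply: Rint_ge0 => u; rewrite mulr_ge0//; case/andP: (W01 (z.1, u));
    case/andP: (W01 (u, z.2)).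
rewrite -[leRHS](prob_int_cst m); apply: bm_int_le => //; first exact: bm_cst.
move=> u; have /andP[? ?] := W01 (z.1, u); have /andP[? ?] := W01 (u, z.2).
by rewrite mulr_ile1.
Qed.

Let W3_ge0 z : 0 <= W3 z.
Proof.
apply: Rint_ge0 => u; rewrite mulr_ge0//.
- by case/andP: (W01 (z.1, u)).
- by case/andP: (W2_01 (u, z.2)).
Qed.

(** The integral of [W2] is that of the squared degree function [D], so Cauchy-Schwarz against the
    constant 1 suffices. *)
Lemma edge_density_sqr_le :
  (\int[(m \x m)%E]_z W z) ^+ 2 <= \int[(m \x m)%E]_z W2 z.
Proof.
pose D u := \int[m]_x W (x, u).
have bD : bounded_meas D.
  apply: (@bm_int _ _ _ _ _ m m (fun w => W (w.2, w.1))).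
  by apply: (bm_comp (h := fun w : T * T => (w.2, w.1))) => //; meas_proj.
have -> : \int[(m \x m)%E]_z W2 z = \int[m]_u (D u ^+ 2).
  rewrite bm_fubini1//.
  transitivity (\int[m]_x \int[m]_u (W (x, u) * D u)).
    apply: Rint_eq => x; rewrite /W2 /kcomp /=.
    rewrite (@bm_fubini _ _ _ _ _ m m (fun w => W (x, w.2) * W (w.2, w.1))).
      apply: Rint_eq => u /=; rewrite bm_intZl.
        by congr (_ * _); apply: Rint_eq => y; exact: symW.
      exact: bm_section1.
    apply: bmM.
      by apply: (bm_comp (h := fun w : T * T => (x, w.2))) => //; meas_proj.
    by apply: (bm_comp (h := fun w : T * T => (w.2, w.1))) => //; meas_proj.
  rewrite (@bm_fubini _ _ _ _ _ m m (fun w => W w * D w.2)).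
    apply: Rint_eq => u /=; rewrite bm_intZr ?expr2//.
    exact: bm_section2.
  by apply: bmM => //; apply: bm_comp bD; exact: measurable_snd.
have -> : \int[(m \x m)%E]_z W z = \int[m]_u (1 * D u).
  by rewrite bm_fubini2//; apply: Rint_eq => u; rewrite mul1r.
apply: le_trans (bm_CS m (bm_cst _ _) bD) _.
by rewrite expr1n prob_int_cst mul1r.
Qed.

Lemma graphon_rigidity : 0 < t ->
  \int[(m \x m)%E]_z (W z * (1 - W z) * W3 z ^+ 2) = 0 ->
  {ae (m \x m)%E, forall z, 2 * (W z * W3 z) + W2 z ^+ 2 = 3 * t} ->
  {ae (m \x m)%E, forall z, W z = 1}.
Proof.
move=> t0 iW0 Wcst.
pose mm := (m \x m)%E.
pose s := Num.sqrt (3 * t).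
have s0 : 0 < s by rewrite sqrtr_gt0 mulr_gt0.
have st : s ^+ 2 = 3 * t by rewrite sqr_sqrtr// mulr_ge0// ltW.
have b1W : bounded_meas (fun z => 1 - W z) by apply: bmB => //; exact: bm_cst.
have W1W_ge0 z : 0 <= W z * (1 - W z) * W3 z ^+ 2.
  by have /andP[? ?] := W01 z; rewrite !mulr_ge0 ?sqr_ge0// subr_ge0.
have W01ae := bm_int0_ae (bmM (bmM bW b1W) (bmX 2 bW3)) W1W_ge0 iW0.
pose A := [set z | 0 < W z * W3 z].
have mA : measurable A.
  have := measurable_fun_ltr (measurable_cst (0 : R)) (bmM bW bW3).1.
  by move=> /(_ measurableT [set true] I); rewrite setTI.
pose chi : T * T -> R := \1_A.
have bchi : bounded_meas chi by exact: bm_indic.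
have chi01 z : (A z /\ chi z = 1) \/ (W z * W3 z = 0 /\ chi z = 0).
  rewrite /chi indicE; have [/set_mem ?|] := boolP (z \in A).
    by left.
  move=> nA; right.
  split=> //; apply/le_anti; have /andP[? ?] := W01 z.
  rewrite mulr_ge0// andbT leNgt; apply/negP => h.
  by move/negP: nA; apply; rewrite inE.
have key : {ae mm, forall z, [/\ chi z * W z = chi z,
     chi z * W2 z ^+ 2 = s ^+ 2 * chi z - 2 * (W z * W3 z),
     W2 z = s * (1 - chi z) + chi z * W2 z &
     s * (1 - chi z) = W2 z * (1 - chi z)]}.
  apply: filterS2 W01ae Wcst => z W0 Wc.
  have /andP[W2ge0 _] := W2_01 z.
  have [[Az ->]|[WW3 ->]] := chi01 z.
    have W1 : W z = 1.
      move: Az; rewrite /A /= => Az; have /andP[Wge0 Wle1] := W01 z.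
      have Wz0 : W z != 0 by apply: contraTneq Az => ->; rewrite mul0r ltxx.
      have W3z0 : W3 z != 0 by apply: contraTneq Az => ->; rewrite mulr0 ltxx.
      move/eqP: W0; rewrite mulf_eq0 sqrf_eq0 (negPf W3z0) orbF mulf_eq0.
      by rewrite (negPf Wz0)/= subr_eq0 => /eqP.
    by move: Wc; rewrite W1 => Wc; split; rewrite ?st; lra.
  have W2s : W2 z = s.
    apply/eqP; rewrite -(eqrXn2 (n := 2))// ?(ltW s0)// st -Wc WW3 mulr0 add0r.
    by [].
  by split; rewrite ?WW3 ?W2s; ring.
pose a := \int[mm]_z chi z.
pose r := \int[mm]_z (chi z * W2 z).
have bsc : bounded_meas (fun z => s * (1 - chi z)) by bm_tac.
have b1c : bounded_meas (fun z => 1 - chi z) by bm_tac.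
have i1c : \int[mm]_z (1 - chi z) = 1 - a.
  by rewrite bm_intB// ?prob_int_cst//; exact: bm_cst.
have wE : \int[mm]_z W2 z = s * (1 - a) + r.
  rewrite (@bm_int_ae _ _ _ mm _ (fun z => s * (1 - chi z) + chi z * W2 z))//.
  - by rewrite bm_intD//; [rewrite bm_intZl// i1c|exact: bmM].
  - by apply: bmD => //; exact: bmM.
  - by apply: filterS key => z [].
have qE : \int[mm]_z (chi z * W2 z ^+ 2) = s ^+ 2 * a - 2 * t.
  rewrite (@bm_int_ae _ _ _ mm _
    (fun z => s ^+ 2 * chi z - 2 * (W z * W3 z)))//; try by bm_tac.
  - rewrite bm_intB; try by bm_tac.
    rewrite !bm_intZl; try by bm_tac.
    (* Self-adjointness moves one factor across: <W, W_3> = <W_2, W_2> = t. *)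
    by congr (_ - _ * _); rewrite -[LHS]/(hsip m W W3) /W3 -hsip_kcomp_adj.
  - by apply: filterS key => z [].
have a0 : 0 <= a.
  by apply: Rint_ge0 => z; have [[_ ->]|[_ ->]] := chi01 z.
have a_p : a <= \int[mm]_z W z.
  rewrite /a (@bm_int_ae _ _ _ mm chi (fun z => chi z * W z))//; try by bm_tac.
    apply: bm_int_le => //; first exact: bmM.
    move=> z; have /andP[? _] := W01 z.
    by have [[_ ->]|[_ ->]] := chi01 z; rewrite ?mul1r ?mul0r.
  by apply: filterS key => z [].
have a_w : a ^+ 2 <= \int[mm]_z W2 z.
  by apply: le_trans edge_density_sqr_le; rewrite lerXn2r// nnegrE// (le_trans a0).
have r2 : r ^+ 2 <= a * (s ^+ 2 * a - 2 * t).
  have := bm_CS mm bchi (bmM bchi bW2).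
  have -> : \int[mm]_z (chi z * (chi z * W2 z)) = r.
    by apply: Rint_eq => z; have [[_ ->]|[_ ->]] := chi01 z; ring.
  have -> : \int[mm]_z (chi z ^+ 2) = a.
    by apply: Rint_eq => z; have [[_ ->]|[_ ->]] := chi01 z; ring.
  have -> // : \int[mm]_z ((chi z * W2 z) ^+ 2) = s ^+ 2 * a - 2 * t.
  by rewrite -qE; apply: Rint_eq => z; have [[_ ->]|[_ ->]] := chi01 z; ring.
have q0 : 0 <= s ^+ 2 * a - 2 * t.
  by rewrite -qE; apply: Rint_ge0 => z; have [[_ ->]|[_ ->]] := chi01 z;
    rewrite ?mul1r ?mul0r// sqr_ge0.
have [a1|a1] := ltP a 1.
  exfalso; apply: (extremal_arith s0 st a0 a1 _ wE a_w r2 q0).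
  (* Off [A], a set of positive measure 1 - a, the function [W2] is equal to [s] and at most 1; this
     yields s <= 1. *)
  have : \int[mm]_z (s * (1 - chi z)) <= \int[mm]_z (1 - chi z).
    rewrite (@bm_int_ae _ _ _ mm _ (fun z => W2 z * (1 - chi z)))//.
    - apply: bm_int_le => //; first exact: bmM.
      move=> z; have /andP[_ ?] := W2_01 z.
      by have [[_ ->]|[_ ->]] := chi01 z; rewrite ?subrr ?mulr0// subr0 mulr1.
    - exact: bmM.
    - by apply: filterS key => z [].
  by rewrite bm_intZl// i1c ger_pMl// subr_gt0.
have i0 : \int[mm]_z (1 - W z) = 0.
  apply/le_anti/andP; split; last first.
    by apply: Rint_ge0 => z; have /andP[_ ?] := W01 z; rewrite subr_ge0.
  rewrite bm_intB//; last exact: bm_cst.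
  by rewrite prob_int_cst subr_le0 (le_trans a1).
have := bm_int0_ae b1W (fun z => ltac:(by have /andP[_ ?] := W01 z; rewrite subr_ge0)) i0.
by apply: filterS => z /eqP; rewrite subr_eq0 eq_sym => /eqP.
Qed.

End GraphonRigidity.

(** * Homomorphism densities *)

Section Environments.
Context (R : realType) d0 (T : measurableType d0) (m : probability T R) (V : eqType).
Implicit Types (f g : (V -> T) -> R) (x : V -> T).

(* Measurability of a function of a family of points is tested along all
   measurable families, which avoids a product sigma-algebra on V -> T. *)
Definition env_bm f :=
  (forall d (X : measurableType d) (h : V -> X -> T),
     (forall v, measurable_fun setT (h v)) ->
     measurable_fun setT (fun w => f (fun v => h v w))) /\
  exists M, forall x, `|f x| <= M.

Lemma env_bm_plot f d (X : measurableType d) (h : V -> X -> T) :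
  env_bm f -> (forall v, measurable_fun setT (h v)) ->
  bounded_meas (fun w => f (fun v => h v w)).
Proof. by move=> [mf [M fM]] mh; split; [exact: mf | exists M]. Qed.

Lemma env_bmP f :
  (forall d (X : measurableType d) (h : V -> X -> T),
     (forall v, measurable_fun setT (h v)) ->
     bounded_meas (fun w => f (fun v => h v w))) ->
  (exists M, forall x, `|f x| <= M) -> env_bm f.
Proof. by move=> fh fM; split=> // d X h mh; case: (fh _ _ _ mh). Qed.

Lemma env_upd_meas d (X : measurableType d) (h : V -> X -> T) v (k : X -> T) :
  (forall w, measurable_fun setT (h w)) -> measurable_fun setT k ->
  forall w, measurable_fun setT (fun z => [eta (h ^~ z) with v |-> k z] w).
Proof. by move=> mh mk w /=; case: (w == v). Qed.

Lemma bm_upd f v x : env_bm f -> bounded_meas (fun u => f [eta x with v |-> u]).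
Proof.
move=> bf; apply: (@env_bm_plot f _ _ (fun w u => [eta x with v |-> u] w)) => //.
apply: (env_upd_meas (h := fun w _ => x w)); last exact: measurable_id.
by move=> w; exact: measurable_cst.
Qed.

Lemma env_bm_int f v : env_bm f ->
  env_bm (fun x => \int[m]_u f [eta x with v |-> u]).
Proof.
move=> bf; have [M fM] := bf.2; apply: env_bmP; last first.
  by exists M => x; apply: bm_int_norm => //; exact: bm_upd.
move=> d X h mh.
(* The measure put on the parameter space X is irrelevant. *)
apply: (@bm_int R _ X _ _ (dirac (point : X)) m
  (fun w : X * T => f [eta (h ^~ w.1) with v |-> w.2])).
apply: (@env_bm_plot f _ _ (fun u w => [eta (h ^~ w.1) with v |-> w.2] u)) => //.
apply: (env_upd_meas (h := fun w z => h w z.1)) => [w|]; last exact: measurable_snd.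
exact: measurableT_comp (mh w) measurable_fst.
Qed.

(** The counterpart of [int_cube] for a probability measure; [int_cubeE] passes from one to the
    other. *)
Fixpoint cube (s : seq V) f x : R :=
  if s is v :: s' then \int[m]_u cube s' f [eta x with v |-> u] else f x.

Lemma env_bm_cube s f : env_bm f -> env_bm (cube s f).
Proof.
move=> bf; elim: s => [|v s ih] /=; first by case: bf => mf [M fM]; split; [|exists M].
exact: env_bm_int.
Qed.

Lemma cube_le s f g x : env_bm f -> env_bm g -> (forall x, f x <= g x) ->
  cube s f x <= cube s g x.
Proof.
move=> bf bg fg; elim: s x => [|v s ih] x //=.
by apply: bm_int_le => [||u]; [apply: bm_upd; exact: env_bm_cube..|].
Qed.

Lemma eq_cube s f g : f =1 g -> cube s f =1 cube s g.
Proof.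
by move=> fg; elim: s => [|v s ih] x //=; apply: Rint_eq => u; rewrite ih.
Qed.

Lemma cube_swap s f v w x : env_bm f ->
  cube [:: v, w & s] f x = cube [:: w, v & s] f x.
Proof.
move=> bf /=; have [->//|vw] := eqVneq v w.
rewrite (@bm_fubini _ _ _ _ _ m m
   (fun z => cube s f [eta [eta x with v |-> z.1] with w |-> z.2])).
  apply: Rint_eq => u; apply: Rint_eq => u' /=; congr cube; apply/funext => z /=.
  have [->|zv] := eqVneq z v; last by [].
  by rewrite (negPf vw).
apply: (@env_bm_plot _ _ _
  (fun u z => [eta [eta x with v |-> z.1] with w |-> z.2] u)).
  exact: env_bm_cube.
apply: (env_upd_meas (h := fun u z => [eta x with v |-> z.1] u));
  last exact: measurable_snd.
apply: (env_upd_meas (h := fun u z => x u)); last exact: measurable_fst.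
by move=> u; exact: measurable_cst.
Qed.

(** Adjacent swaps by Fubini generate all permutations. Each density can thus be computed in the
    order of integration that exposes its paths. *)
Lemma cube_perm s1 s2 f x : env_bm f -> perm_eq s1 s2 -> cube s1 f x = cube s2 f x.
Proof.
move=> bf; elim: s1 s2 x => [|v s1 ih] s2 x.
  by rewrite perm_sym => /perm_nilP ->.
move=> p; have : v \in s2 by rewrite -(perm_mem p) mem_head.
move=> vs2; case: (path.splitPr vs2) p => t1 t2 p.
have {p}/ih e : perm_eq s1 (t1 ++ t2).
  rewrite -(perm_cons v); apply: (perm_trans p).
  by apply/permPl; exact: (perm_catCA t1 [:: v] t2).
have -> : cube (v :: s1) f x = cube (v :: t1 ++ t2) f x by apply: Rint_eq => u; exact: e.
elim: t1 x {e} => // w t1 ih1 x.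
rewrite cat_cons cube_swap//=; apply: Rint_eq => u; exact: ih1.
Qed.

End Environments.

Section EdgeProducts.
Context (R : realType) d0 (T : measurableType d0) (V : eqType) (W : T * T -> R).

Definition edge_prod (F : mgraph V) (x : V -> T) : R :=
  \prod_(e <- medges F) W (x e.1, x e.2).

(** The counterpart of [t_marked]. The point [x0] is the provisional value of the unmarked vertices;
    the integration overwrites it at those of [mverts F]. *)
Definition marked (m : probability T R) (x0 : T) (F : mgraph V) (as_ : seq V)
    (xs : seq T) : R :=
  cube m [seq v <- mverts F | v \notin as_] (edge_prod F)
    (fun v => nth x0 xs (index v as_)).

Lemma env_bm_edge_prod F : bounded_meas W -> env_bm (edge_prod F).
Proof.
move=> bW; apply: env_bmP.
  move=> d X h mh; apply: bm_prod => e _.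
  apply: (bm_comp (h := fun w => (h e.1 w, h e.2 w))) => //.
  by apply/measurable_fun_pair; exact: mh.
have [M WM] := bW.2; exists (M ^+ size (medges F)) => x.
rewrite /edge_prod; elim: (medges F) => [|e s ih].
  by rewrite big_nil normr1 expr0.
by rewrite big_cons normrM exprS ler_pM.
Qed.

Lemma marked_perm m x0 F as_ xs s : bounded_meas W ->
  perm_eq [seq v <- mverts F | v \notin as_] s ->
  marked m x0 F as_ xs = cube m s (edge_prod F) (fun v => nth x0 xs (index v as_)).
Proof. by move=> bW p; apply: cube_perm p; exact: env_bm_edge_prod. Qed.

End EdgeProducts.

Lemma int_prod2 (R : realType) d (X : measurableType d) (P : probability X R)
    d' (Y : measurableType d') (Q : probability Y R) (g : X -> R) (h : Y -> R) r :
  bounded_meas g -> bounded_meas h ->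
  \int[P]_u \int[Q]_v (r * (g u * h v)) = r * (\int[P]_u g u * \int[Q]_v h v).
Proof.
move=> bg bh; transitivity (\int[P]_u (r * (g u * \int[Q]_v h v))).
  apply: Rint_eq => u; rewrite bm_intZl; last by bm_tac.
  by rewrite bm_intZl.
rewrite bm_intZl; last by apply: bmM => //; exact: bm_cst.
by rewrite bm_intZr.
Qed.

Local Notation o0 := (@Ordinal 4 0 isT).
Local Notation o1 := (@Ordinal 4 1 isT).
Local Notation o2 := (@Ordinal 4 2 isT).
Local Notation o3 := (@Ordinal 4 3 isT).

Lemma enum_I4 : enum 'I_4 = [:: o0; o1; o2; o3].
Proof. by apply: (inj_map val_inj); rewrite val_enum_ord. Qed.

Lemma I4_cases (P : 'I_4 -> Prop) : P o0 -> P o1 -> P o2 -> P o3 ->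
  forall a, P a.
Proof.
move=> P0 P1 P2 P3 a; have : a \in enum 'I_4 by rewrite mem_enum.
by rewrite enum_I4 !inE => /or4P[] /eqP->.
Qed.

Lemma sedges_C4 : perm_eq (sedges C4) [:: (o0, o1); (o1, o2); (o2, o3); (o0, o3)].
Proof.
apply: uniq_perm => [||[a b]].
- by rewrite filter_uniq// enum_uniq.
- by [].
rewrite mem_filter mem_enum andbT.
by elim/I4_cases : a; elim/I4_cases : b.
Qed.

Section GluedDensities.
Context (R : realType) d (T : measurableType d) (m : probability T R) (x0 : T).
Variable W : T * T -> R.
Hypothesis bW : bounded_meas W.
Hypothesis W01 : forall z, 0 <= W z <= 1.

(** The integrands differ by the factors of the edges of the second copy that join its two
    identified vertices, and these factors lie in [0,1]. Hence every summand of [sigma2] is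
    non-negative. *)
Lemma marked_oplus_le (H : sgraph) (a b c e : 'I_(nv H)) :
  marked W m x0 (oplus a b c e) [::] [::] <= marked W m x0 (ominus a b c e) [::] [::].
Proof.
apply: cube_le; [exact: env_bm_edge_prod..|move=> x].
rewrite /edge_prod /= !big_cat /=; apply: ler_wpM2l.
  by apply: prodr_ge0 => f _; have /andP[] := W01 (x f.1, x f.2).
rewrite !big_map big_filter [leLHS](bigID (fun f => f \notin [:: (c, e); (e, c)])) /=.
apply: ler_piMr.
  apply: prodr_ge0 => f _.
  by case/andP: (W01 (x (glue_edge a b c e f).1, x (glue_edge a b c e f).2)).
by apply: prodr_ile1 => f _; exact: W01.
Qed.

End GluedDensities.

(** * Densities of the 4-cycle and of two 4-cycles glued along an edge *)

Section C4Densities.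
Context (R : realType) d (T : measurableType d) (m : probability T R) (x0 : T).
Variable W : T * T -> R.
Hypothesis bW : bounded_meas W.
Hypothesis symW : forall x y, W (x, y) = W (y, x).

Let W2 := kcomp m W W.
Let W3 := kcomp m W W2.

Let C4_prodE x : edge_prod W (mgraph_of C4) x =
  W (x o0, x o1) * W (x o1, x o2) * W (x o2, x o3) * W (x o0, x o3).
Proof. by rewrite /edge_prod (perm_big _ sedges_C4) !big_cons big_nil /=; ring. Qed.

Let bm_W1 x : bounded_meas (fun u => W (x, u)). Proof. exact: bm_section1. Qed.
Let bm_W2 y : bounded_meas (fun u => W (u, y)). Proof. exact: bm_section2. Qed.

Let W_path3 x y : W3 (x, y) = \int[m]_u \int[m]_v (W (x, u) * (W (u, v) * W (v, y))).
Proof.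
rewrite /W3 /kcomp /=; apply: Rint_eq => u; rewrite bm_intZl//.
by apply: bmM; [exact: bm_W1 | exact: bm_W2].
Qed.

Lemma int_path3 x y : \int[m]_u \int[m]_v (W (x, y) * (W (x, u) * (W (u, v) * W (v, y))))
  = W (x, y) * W3 (x, y).
Proof.
have bs : bounded_meas (fun w : T * T => W (x, w.1) * (W w * W (w.2, y))).
  apply: bmM; last apply: bmM => //.
  - exact: bm_comp measurable_fst (bm_W1 x).
  - exact: bm_comp measurable_snd (bm_W2 y).
rewrite W_path3 -bm_intZl; last exact: (bm_int m m bs).
by apply: Rint_eq => u; rewrite -bm_intZl//; exact: (bm_section1 u bs).
Qed.

Lemma int_path22 x y :
  \int[m]_u \int[m]_v (1 * ((W (x, u) * W (u, y)) * (W (x, v) * W (v, y))))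
  = W2 (x, y) ^+ 2.
Proof.
have bs : bounded_meas (fun u => W (x, u) * W (u, y)).
  by apply: bmM; [exact: bm_W1 | exact: bm_W2].
by rewrite int_prod2// mul1r expr2.
Qed.

(** The list [s] gives the two unmarked vertices. For adjacent marks it follows the 3-path from the
    vertex at [x] to the vertex at [y], so that the integrand matches [int_path3] up to the symmetry
    of [W]. *)
Ltac marked2 s x y := rewrite (marked_perm m x0 (s := s) _ bW); [|by rewrite /= enum_I4];
  rewrite -?int_path3 -?int_path22 /=; apply: Rint_eq; let u := fresh "u" in intro u;
  apply: Rint_eq; let v := fresh "v" in intro v;
  rewrite C4_prodE /= ?(symW y x) ?(symW u x) ?(symW v x) ?(symW v u)
    ?(symW y u) ?(symW y v); ring.

(** Two adjacent vertices of the cycle are joined by their edge and a 3-path, two opposite ones by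
    two 2-paths. *)
Lemma C4_marked2 a b x y : a != b -> marked W m x0 (mgraph_of C4) [:: a; b] [:: x; y] =
  if adj C4 a b then W (x, y) * W3 (x, y) else W2 (x, y) ^+ 2.
Proof.
elim/I4_cases : a; elim/I4_cases : b => //= _.
- marked2 [:: o3; o2] x y.
- marked2 [:: o1; o3] x y.
- marked2 [:: o1; o2] x y.
- marked2 [:: o2; o3] x y.
- marked2 [:: o0; o3] x y.
- marked2 [:: o0; o2] x y.
- marked2 [:: o1; o3] x y.
- marked2 [:: o3; o0] x y.
- marked2 [:: o1; o0] x y.
- marked2 [:: o2; o1] x y.
- marked2 [:: o0; o2] x y.
- marked2 [:: o0; o1] x y.
Qed.

Ltac marked1 s x := rewrite (marked_perm m x0 (s := s) _ bW); [|by rewrite /= enum_I4];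
  rewrite /=; apply: Rint_eq; let y := fresh "y" in intro y;
  rewrite -int_path22; apply: Rint_eq; let u := fresh "u" in intro u;
  apply: Rint_eq; let v := fresh "v" in intro v;
  rewrite C4_prodE /= ?(symW y x) ?(symW u x) ?(symW v x) ?(symW v u)
    ?(symW y u) ?(symW y v); ring.

Lemma C4_marked1 a x :
  marked W m x0 (mgraph_of C4) [:: a] [:: x] = \int[m]_y (W2 (x, y) ^+ 2).
Proof.
elim/I4_cases : a.
- marked1 [:: o2; o1; o3] x.
- marked1 [:: o3; o0; o2] x.
- marked1 [:: o0; o1; o3] x.
- marked1 [:: o1; o0; o2] x.
Qed.

Lemma C4_marked0 : marked W m x0 (mgraph_of C4) [::] [::] = hsip m W2 W2.
Proof.
rewrite (marked_perm m x0 (s := [:: o0; o2; o1; o3]) _ bW); last by rewrite /= enum_I4.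
have bW2 : bounded_meas W2 by exact: bm_kcomp.
rewrite /hsip bm_fubini1; last exact: bmM.
apply: Rint_eq => x; apply: Rint_eq => y; rewrite -expr2 -int_path22.
apply: Rint_eq => u; apply: Rint_eq => v.
by rewrite C4_prodE /= ?(symW y x) ?(symW u x) ?(symW v x) ?(symW v u)
    ?(symW y u) ?(symW y v); ring.
Qed.

(** Both sides are the diagonal value at [x] of the fourth operator power of [W], split as 1 + 3 and
    as 2 + 2. *)
Lemma int_C4_edge_marked x :
  \int[m]_y (W (x, y) * W3 (x, y)) = \int[m]_y (W2 (x, y) ^+ 2).
Proof.
have -> : \int[m]_y (W (x, y) * W3 (x, y)) = kcomp m (kiter m W 0) (kiter m W 2) (x, x).
  apply: Rint_eq => y; congr (_ * _).
  by rewrite -[W3]/(kiter m W 2) (kiter_sym m bW symW).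
rewrite (kcomp_kiter m bW 0 2) -(kcomp_kiter m bW 1 1).
apply: Rint_eq => y; rewrite expr2 -[W2]/(kiter m W 1).
by rewrite [kiter m W 1 (y, _)](kiter_sym m bW symW).
Qed.

Let glued01 : perm_eq (glued_verts o0 o1 o0 o1)
  [:: inl o0; inl o1; inl o3; inl o2; inr o3; inr o2].
Proof.
apply: uniq_perm => [||v]; [exact: undup_uniq|by []|].
rewrite mem_undup; apply/mapP/idP => [[u _ ->]|].
  by case: u; elim/I4_cases.
by case: v; elim/I4_cases => // _;
  [exists (inl o0)|exists (inl o1)|exists (inl o2)|exists (inl o3)|
   exists (inr o2)|exists (inr o3)] => //; rewrite mem_enum.
Qed.

Let path3_pair x y (g : R) :
  \int[m]_u \int[m]_v \int[m]_u' \int[m]_v'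
    (g * ((W (x, u) * (W (u, v) * W (v, y))) * (W (x, u') * (W (u', v') * W (v', y)))))
  = g * W3 (x, y) ^+ 2.
Proof.
have bs : bounded_meas (fun w : T * T => W (x, w.1) * (W w * W (w.2, y))).
  apply: bmM; last apply: bmM => //.
  - exact: bm_comp measurable_fst (bm_W1 x).
  - exact: bm_comp measurable_snd (bm_W2 y).
have h u v : \int[m]_u' \int[m]_v'
    (g * ((W (x, u) * (W (u, v) * W (v, y))) * (W (x, u') * (W (u', v') * W (v', y)))))
    = \int[(m \x m)%E]_z (g * ((W (x, u) * (W (u, v) * W (v, y))) *
        (W (x, z.1) * (W z * W (z.2, y))))).
  rewrite bm_fubini1//; apply: bmM; first exact: bm_cst.
  by apply: bmM => //; exact: bm_cst.
transitivity (\int[(m \x m)%E]_w \int[(m \x m)%E]_z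
   (g * ((W (x, w.1) * (W w * W (w.2, y))) * (W (x, z.1) * (W z * W (z.2, y)))))).
  rewrite bm_fubini1.
    by apply: Rint_eq => u; apply: Rint_eq => v; exact: h.
  apply: (@bm_int _ _ _ _ _ (m \x m)%E (m \x m)%E (fun q : (T * T) * (T * T) =>
    g * ((W (x, q.1.1) * (W q.1 * W (q.1.2, y))) *
         (W (x, q.2.1) * (W q.2 * W (q.2.2, y)))))).
  apply: bmM; first exact: bm_cst.
  by apply: bmM; [apply: bm_comp bs; exact: measurable_fst|
                  apply: bm_comp bs; exact: measurable_snd].
rewrite int_prod2// -expr2; congr (_ * _ ^+ 2).
by rewrite bm_fubini1// W_path3.
Qed.

(** Both glued graphs consist of the common edge and two 3-paths between its ends. A single edge
    gives the integral of W W_3^2, a double edge that of W^2 W_3^2. *)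
Lemma C4_ominus_oplus :
  marked W m x0 (@ominus C4 o0 o1 o0 o1) [::] [::] -
  marked W m x0 (@oplus C4 o0 o1 o0 o1) [::] [::] =
  \int[(m \x m)%E]_z (W z * (1 - W z) * W3 z ^+ 2).
Proof.
have bW2 : bounded_meas W2 by exact: bm_kcomp.
have bW3 : bounded_meas W3 by exact: bm_kcomp.
have minusE x : edge_prod W (@ominus C4 o0 o1 o0 o1) x =
   W (x (inl o0), x (inl o1)) * W (x (inl o1), x (inl o2)) *
   W (x (inl o2), x (inl o3)) * W (x (inl o0), x (inl o3)) *
   (W (x (inl o1), x (inr o2)) * W (x (inr o2), x (inr o3)) *
    W (x (inl o0), x (inr o3))).
  rewrite /edge_prod /= big_cat /= !big_map big_filter.
  by rewrite !(perm_big _ sedges_C4) /= !big_cons !big_nil /=; ring.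
have plusE x : edge_prod W (@oplus C4 o0 o1 o0 o1) x =
   W (x (inl o0), x (inl o1)) * edge_prod W (@ominus C4 o0 o1 o0 o1) x.
  rewrite minusE /edge_prod /= big_cat /= !big_map.
  by rewrite !(perm_big _ sedges_C4) /= !big_cons !big_nil /=; ring.
(* The parameter [g] is the weight of the common edge, which alone distinguishes the two graphs. *)
have mE F g : edge_prod W F =1 (fun x => g (x (inl o0)) (x (inl o1)) *
   (W (x (inl o1), x (inl o2)) *
   W (x (inl o2), x (inl o3)) * W (x (inl o0), x (inl o3)) *
   (W (x (inl o1), x (inr o2)) * W (x (inr o2), x (inr o3)) *
    W (x (inl o0), x (inr o3))))) -> mverts F = glued_verts o0 o1 o0 o1 ->
  marked W m x0 F [::] [::] = \int[m]_x \int[m]_y (g x y * W3 (x, y) ^+ 2).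
  move=> FE vF.
  rewrite (marked_perm m x0
    (s := [:: inl o0; inl o1; inl o3; inl o2; inr o3; inr o2]) _ bW).
    rewrite (eq_cube _ _ FE) /=; apply: Rint_eq => x; apply: Rint_eq => y.
    rewrite -path3_pair; apply: Rint_eq => u; apply: Rint_eq => v.
    apply: Rint_eq => u'; apply: Rint_eq => v'.
    by rewrite (symW v u) (symW y v) (symW y v') (symW v' u'); ring.
  by rewrite vF filter_predT.
rewrite (mE (@ominus C4 o0 o1 o0 o1) (fun x y => W (x, y))) => [||//]; last first.
  by move=> x; rewrite minusE; ring.
rewrite (mE (@oplus C4 o0 o1 o0 o1) (fun x y => W (x, y) ^+ 2)) => [||//]; last first.
  by move=> x; rewrite plusE minusE; ring.
have -> : \int[m]_x \int[m]_y (W (x, y) * W3 (x, y) ^+ 2) =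
  \int[(m \x m)%E]_z (W z * W3 z ^+ 2) by rewrite bm_fubini1//; bm_tac.
have -> : \int[m]_x \int[m]_y (W (x, y) ^+ 2 * W3 (x, y) ^+ 2) =
  \int[(m \x m)%E]_z (W z ^+ 2 * W3 z ^+ 2) by rewrite bm_fubini1//; bm_tac.
rewrite -bm_intB; try by bm_tac.
by apply: Rint_eq => z; ring.
Qed.

End C4Densities.

(** * Graphons on the unit interval *)

Section UnitInterval.
Context (R : realType).

(* [lebesgue_measure] lives on [measurableTypeR R], which has the sigma-algebra of
   [R] but a different display. *)
Definition unif : probability (measurableTypeR R) R := uniform_prob (@ltr01 R).

Lemma measurable_I01 : measurable (@I01 R).
Proof. exact: measurable_itv. Qed.

Lemma unif_nneg_int (g : measurableTypeR R -> \bar R) :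
  measurable_fun setT g -> (forall x, 0 <= g x)%E ->
  (\int[unif]_x g x = \int[lebesgue_measure]_(x in I01) g x)%E.
Proof. by move=> mg g0; rewrite integral_uniform// subr0 invr1 mul1e. Qed.

Lemma unif_set (A : set (measurableTypeR R)) : measurable A ->
  unif A = lebesgue_measure (A `&` I01).
Proof.
move=> mA; have := unif_nneg_int (g := fun x => (\1_A x)%:E).
rewrite integral_indic// setIT => ->.
- by rewrite integral_indic//; exact: measurable_I01.
- exact/measurable_EFinP/measurable_indic.
- by move=> x; rewrite lee_fin indicE.
Qed.

Lemma I01_bm_integrable (g : measurableTypeR R -> R) : bounded_meas g ->
  (@lebesgue_measure R).-integrable I01 (EFin \o g).
Proof.
move=> [mg [M gM]]; apply: measurable_bounded_integrable.
- exact: measurable_I01.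
- by rewrite /I01 /= lebesgue_measure_itv/= lte_fin ltr01 -EFinB ltry.
- exact: measurable_funTS.
- exists M; split; [exact: num_real|move=> N MN x _].
  exact: le_trans (gM x) (ltW MN).
Qed.

Lemma unif_int (g : measurableTypeR R -> R) : bounded_meas g ->
  \int[lebesgue_measure]_(x in I01) g x = \int[unif]_x g x.
Proof.
move=> bg; have [mg [M gM]] := bg.
(* Adding the bound [M] makes the function non-negative, as [unif_nneg_int] requires; the unit
   interval has measure 1, so [M] cancels afterwards. *)
have bgM : bounded_meas (fun x => g x + M) by apply: bmD => //; exact: bm_cst.
have g0 x : 0 <= g x + M.
  by rewrite -lerBlDr sub0r; have := gM x; rewrite ler_norml => /andP[].
have h : \int[lebesgue_measure]_(x in I01) (g x + M) = \int[unif]_x (g x + M).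
  rewrite /Rintegral (unif_nneg_int (g := fun x => (g x + M)%:E))//.
  exact: (proj2 (measurable_EFinP _ _) bgM.1).
have bM : bounded_meas (fun _ : measurableTypeR R => M) by exact: bm_cst.
move: h; rewrite bm_intD// prob_int_cst.
rewrite RintegralD; [|exact: measurable_I01|exact: I01_bm_integrable..].
rewrite Rintegral_cst; last exact: measurable_I01.
rewrite [X in M * fine X](_ : _ = 1%E).
  by rewrite mulr1 => /addIr.
by rewrite /I01 /= lebesgue_measure_itv/= lte_fin ltr01 -EFinB subr0.
Qed.

Lemma unif_ae (P : measurableTypeR R -> Prop) :
  {ae unif, forall x, P x} <-> {ae lebesgue_measure, forall x, I01 x -> P x}.
Proof.
split=> -[B [mB B0 PB]].
- exists (B `&` I01); split.
  + by apply: measurableI => //; exact: measurable_I01.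
  + by rewrite -unif_set.
  + move=> x /= nP; split; first by apply: PB => /= Px; apply: nP.
    by apply: contrapT => nI; apply: nP.
- exists (B `|` ~` I01); split.
  + by apply: measurableU => //; apply: measurableC; exact: measurable_I01.
  + rewrite unif_set; last first.
      by apply: measurableU => //; apply: measurableC; exact: measurable_I01.
    rewrite setIUl setICl setU0; apply: (subset_measure0 _ _ _ B0) => //.
    by apply: measurableI => //; exact: measurable_I01.
  + move=> x /= nP; have [Ix|nI] := pselect (I01 x); [left|by right].
    by apply: PB => /= h; apply: nP; exact: h.
Qed.

Lemma unif2_ae (P : measurableTypeR R * measurableTypeR R -> Prop) :
  {ae (unif \x unif)%E, forall z, (I01 `*` I01) z -> P z} ->
  {ae (@lebesgue_measure R \x @lebesgue_measure R)%E,
     forall z, (I01 `*` I01) z -> P z}.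
Proof.
move=> [B [mB B0 PB]].
have mI2 : measurable (@I01 R `*` @I01 R) by apply: measurableX; exact: measurable_I01.
exists (B `&` (I01 `*` I01)); split.
- exact: measurableI.
- rewrite -B0; rewrite /product_measure1.
  transitivity (\int[lebesgue_measure]_(x in I01) (unif (xsection B x)))%E.
    rewrite [RHS]integral_mkcond; apply: eq_integral => x _.
    rewrite patchE; case: ifPn => [/set_mem Ix|/negP nI] /=.
      rewrite unif_set; last exact: measurable_xsection.
      congr lebesgue_measure; apply/seteqP; split => y; rewrite /xsection /= !inE.
        by move=> [Bxy [_ Iy]].
      by move=> [Bxy Iy].
    rewrite (_ : xsection _ x = set0) ?measure0//.
    apply/seteqP; split => y //; rewrite /xsection /= inE => -[_ [Ix _]].
    by apply: nI; rewrite inE.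
  rewrite unif_nneg_int//.
  exact: measurable_fun_xsection.
- move=> z /= nP; split; first exact: PB.
  by apply: contrapT => nI; apply: nP.
Qed.

Definition clamp01 (x : R) : R := Num.max 0 (Num.min x 1).

Lemma clamp01_I01 x : I01 (clamp01 x).
Proof.
by rewrite /I01 /= in_itv /= /clamp01 le_max lexx /= ge_max ler01 ge_min lexx orbT.
Qed.

Lemma clamp01_id x : I01 x -> clamp01 x = x.
Proof.
rewrite /I01 /= in_itv /= /clamp01 => /andP[x0 x1].
by rewrite (min_idPl x1) (max_idPr x0).
Qed.

Lemma measurable_clamp01 : measurable_fun (T := measurableTypeR R) setT clamp01.
Proof.
by apply: measurable_maxr => //; apply: measurable_minr.
Qed.

Variable W : R * R -> R.
Hypothesis hW : is_graphon W.

(* Nothing is known about W outside the unit square; clampW is a total symmetric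
   measurable kernel that agrees with W there. *)
Definition clampW (z : measurableTypeR R * measurableTypeR R) : R :=
  W (clamp01 z.1, clamp01 z.2).

Lemma clampW_id x y : I01 x -> I01 y -> clampW (x, y) = W (x, y).
Proof. by move=> Ix Iy; rewrite /clampW /= !clamp01_id. Qed.

Lemma clampW_01 z : 0 <= clampW z <= 1.
Proof. by case: hW => _ _ h; apply: h; exact: clamp01_I01. Qed.

Lemma clampW_sym x y : clampW (x, y) = clampW (y, x).
Proof. by case: hW => _ h _; apply: h; exact: clamp01_I01. Qed.

Lemma bm_clampW : bounded_meas clampW.
Proof.
split; last by exists 1 => z; have /andP[? ?] := clampW_01 z; rewrite ger0_norm.
case: hW => mW _ _.
apply: (measurable_comp (F := @I01 R `*` @I01 R) (f := W)
  (g := fun z : R * R => (clamp01 z.1, clamp01 z.2))) => //.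
- by apply: measurableX; exact: measurable_I01.
- by move=> _ [z _ <-]; split; exact: clamp01_I01.
- apply/measurable_fun_pairP; split.
    exact: (measurableT_comp measurable_clamp01 measurable_fst).
  exact: (measurableT_comp measurable_clamp01 measurable_snd).
Qed.

Lemma int_cubeE (V : eqType) (s : seq V) (f : (V -> R) -> R)
  (g : (V -> measurableTypeR R) -> R) (x : V -> R) :
  env_bm g -> (forall y, (forall v, I01 (y v)) -> f y = g y) ->
  (forall v, I01 (x v)) -> int_cube s f x = cube unif s g x.
Proof.
move=> bg fg; elim: s x => [|v s ih] x Ix /=; first exact: fg.
rewrite -unif_int; last by apply: bm_upd; exact: env_bm_cube.
apply: eq_Rintegral => u /set_mem Iu; apply: ih => w /=.
by case: ifP.
Qed.

Lemma t_markedE (V : eqType) (F : mgraph V) (as_ : seq V) (xs : seq R) :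
  (forall x, x \in xs -> I01 x) ->
  t_marked F W as_ xs = marked clampW unif 0 F as_ xs.
Proof.
move=> Ixs; apply: int_cubeE.
- exact: env_bm_edge_prod bm_clampW.
- by move=> y Iy; apply: eq_bigr => e _; rewrite clampW_id.
- move=> v; have [h|h] := ltnP (index v as_) (size xs).
    by apply: Ixs; exact: mem_nth.
  by rewrite nth_default// /I01 /= in_itv /= lexx ler01.
Qed.

End UnitInterval.

Lemma sum_I4 (R : realType) (F : 'I_4 -> R) :
  \sum_(a < 4) F a = F o0 + F o1 + F o2 + F o3.
Proof. by rewrite -big_enum enum_I4 !big_cons big_nil /= addr0 !addrA. Qed.

Lemma card_Aut_gt0 (H : sgraph) : (0 < card_Aut H)%N.
Proof.
rewrite card_gt0; apply/set0Pn; exists (perm.perm_one _).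
rewrite inE; apply/forallP => a; apply/forallP => b.
by rewrite !perm.perm1.
Qed.

(** * The kernel of the 4-cycle and its spectrum *)

Section C4Spectrum.
Context (R : realType) (W : R * R -> R).
Hypothesis hW : is_graphon W.

Local Notation T := (measurableTypeR R).
Local Notation m := (unif R).
Let V : T * T -> R := clampW W.
Let V2 := kcomp m V V.
Let V3 := kcomp m V V2.
Let t := hsip m V2 V2.
Let bV : bounded_meas V := bm_clampW hW.
Let symV : forall x y, V (x, y) = V (y, x) := clampW_sym hW.
Let bV2 : bounded_meas V2. Proof. exact: bm_kcomp. Qed.
Let bV3 : bounded_meas V3. Proof. exact: bm_kcomp. Qed.
Let c : R := (2 * (card_Aut C4)%:R)^-1.

Let c_gt0 : 0 < c.
Proof. by rewrite invr_gt0 mulr_gt0// ltr0n card_Aut_gt0. Qed.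

Lemma t_dens_C4 : t_dens (mgraph_of C4) W = t.
Proof. by rewrite /t_dens (t_markedE hW)//; exact: C4_marked0. Qed.

Let K : T * T -> R := fun z => c * (8 * (V z * V3 z) + 4 * V2 z ^+ 2).

Let bK : bounded_meas K. Proof. by rewrite /K; bm_tac. Qed.

Let V2_sym x y : V2 (x, y) = V2 (y, x).
Proof. exact: (kiter_sym m bV symV 1). Qed.

Let V3_sym x y : V3 (x, y) = V3 (y, x).
Proof. exact: (kiter_sym m bV symV 2). Qed.

Let K_sym x y : K (x, y) = K (y, x).
Proof. by rewrite /K symV V2_sym V3_sym. Qed.

Lemma WH_C4 x y : I01 x -> I01 y -> WH C4 W x y = K (x, y).
Proof.
move=> Ix Iy; rewrite /WH /K; congr (_ * _).
transitivity (\sum_(a < 4) \sum_(b < 4 | a != b)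
   (if adj C4 a b then V (x, y) * V3 (x, y) else V2 (x, y) ^+ 2)).
  apply: eq_bigr => a _; apply: eq_bigr => b ab.
  rewrite (t_markedE hW).
    by rewrite (C4_marked2 _ _ bV).
  by move=> z; rewrite !inE => /orP[] /eqP ->.
by rewrite sum_I4 !(big_mkcond (fun b => _ != b)) !sum_I4 /=; ring.
Qed.

Let d : R := c * (12 * t).

Lemma dWH_C4 : dWH C4 W = d.
Proof.
rewrite /dWH t_dens_C4 /d /c (_ : (nv C4 * (nv C4).-1)%N = 12%N)//; ring.
Qed.

Hypothesis hreg : H_regular C4 W.

Let I01_ae : {ae m, forall x : T, I01 x}.
Proof. by apply/unif_ae; apply: aeW. Qed.

Let reg : {ae m, forall x, \int[m]_y (V2 (x, y) ^+ 2) = t}.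
Proof.
apply: (prob_ae_imp2 _ I01_ae (proj2 (unif_ae _) hreg)) => x Ix.
rewrite t_dens_C4 => <-.
rewrite sum_I4 !(t_markedE hW); try by move=> z; rewrite inE => /eqP->.
by rewrite !C4_marked1// /=; field.
Qed.

(** By [int_C4_edge_marked] both parts of the kernel have the same row integral, which regularity
    fixes to be [t]; the total is 8 t + 4 t. *)
Let K_reg : {ae m, forall x, \int[m]_y K (x, y) = d}.
Proof.
apply: (prob_ae_imp _ reg) => x hx.
have bVx : bounded_meas (fun y => V (x, y) * V3 (x, y)).
  by apply: bmM; exact: bm_section1.
have bV2x : bounded_meas (fun y => V2 (x, y) ^+ 2) by apply: bmX; exact: bm_section1.
rewrite /K bm_intZl; last by bm_tac.
rewrite bm_intD; try by bm_tac.
rewrite !bm_intZl; try by bm_tac.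
rewrite int_C4_edge_marked// -/V2 hx /d; ring.
Qed.

Let eigenK l (f : T -> R) : bounded_meas f ->
  {ae m, forall x, \int[m]_u (K (x, u) * f u) = l * f x} ->
  eigenfunction (WH C4 W) l f.
Proof.
move=> bf eig; split.
- exact: measurable_funTS bf.1.
- exact: (I01_bm_integrable (bmX 2 bf)).
- apply: (proj1 (unif_ae _)); apply: (prob_ae_imp2 _ I01_ae eig) => x Ix eigx.
  rewrite -eigx -unif_int.
    by apply: eq_Rintegral => y /set_mem Iy; rewrite WH_C4.
  by apply: bmM => //; exact: bm_section1.
Qed.

(** An eigenfunction of K - d for some l != 0 has mean 0, because the columns of K - d integrate to
    0; it is therefore an eigenfunction of [K] for the same [l]. The hypothesis leaves only
    multiples of 1, and mean 0 excludes the non-zero ones. *)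
Lemma C4_const_of_trivial_spectrum :
  (forall l : R, l != 0 -> exists k, eigen_dim (WH C4 W) l k /\
     (k - (l == dWH C4 W))%N = 0%N) ->
  {ae (m \x m)%E, forall z, 2 * (V z * V3 z) + V2 z ^+ 2 = 3 * t}.
Proof.
move=> spec.
pose Kd z := K z - d.
have bKd : bounded_meas Kd by apply: bmB => //; exact: bm_cst.
have Kd_sym x y : Kd (x, y) = Kd (y, x) by rewrite /Kd K_sym.
have Kdf x f : bounded_meas f ->
    \int[m]_u (Kd (x, u) * f u) = \int[m]_u (K (x, u) * f u) - d * \int[m]_u f u.
  move=> bf; have bKx : bounded_meas (fun u => K (x, u)) by exact: bm_section1.
  rewrite -bm_intZl// -bm_intB; [|exact: bmM|by apply: bmM => //; exact: bm_cst].
  by apply: Rint_eq => u; rewrite /Kd; ring.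
have noeig l f : l != 0 -> bounded_meas f ->
    {ae m, forall x, \int[m]_u (Kd (x, u) * f u) = l * f x} ->
    {ae m, forall x, f x = 0}.
  move=> l0 bf eig.
  have f0 : \int[m]_x f x = 0.
    apply: (mulfI l0); rewrite mulr0 -bm_intZl//.
    have bKf : bounded_meas (fun x => \int[m]_u (Kd (x, u) * f u)).
      apply: (@bm_int _ _ _ _ _ m m (fun z => Kd z * f z.2)).
      by apply: bmM => //; apply: bm_comp bf; exact: measurable_snd.
    rewrite -(bm_int_ae bKf _ eig); last by apply: bmM => //; exact: bm_cst.
    rewrite (@bm_fubini _ _ _ _ _ m m (fun z => Kd z * f z.2)).
      rewrite -[RHS](prob_int_cst m); apply: bm_int_ae.
      - apply: (@bm_int _ _ _ _ _ m m (fun z => Kd (z.2, z.1) * f z.1)).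
        apply: bmM; last by apply: bm_comp bf; exact: measurable_fst.
        by apply: (bm_comp (h := fun w : T * T => (w.2, w.1))) => //; meas_proj.
      - exact: bm_cst.
      - apply: (prob_ae_imp _ K_reg) => u hu /=.
        have bKu : bounded_meas (fun x => K (x, u)) by exact: bm_section2.
        rewrite bm_intZr; last by apply: bmB => //; exact: bm_cst.
        rewrite bm_intB//; last exact: bm_cst.
        rewrite prob_int_cst.
        have -> : \int[m]_x K (x, u) = d.
          by rewrite -hu; apply: Rint_eq => x; exact: K_sym.
        by rewrite subrr mul0r.
    by apply: bmM => //; apply: bm_comp bf; exact: measurable_snd.
  have eigf : eigenfunction (WH C4 W) l f.
    by apply: eigenK => //; apply: (prob_ae_imp _ eig) => x; rewrite Kdf// f0 mulr0 subr0.
  have [k [[phi [phi_eig phi_free phi_span]] ]] := spec l l0.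
  rewrite dWH_C4; have [l_d|_] := eqVneq l d; last first.
    rewrite subn0 => k0; have [cf hcf] := phi_span f eigf.
    apply: (prob_ae_imp _ (proj2 (unif_ae _) hcf)) => x ->.
    by apply: big1 => -[i ik] _; exfalso; move: ik; rewrite k0.
  move=> /eqP; rewrite subn_eq0 => k1.
  (* When l = d the eigenspace has dimension at most 1 and contains the constant 1, so [f] is
     constant. *)
  have eig1 : eigenfunction (WH C4 W) l (fun=> 1).
    apply: eigenK; first exact: bm_cst.
    apply: (prob_ae_imp _ K_reg) => x hx; rewrite mulr1 l_d -hx.
    by apply: Rint_eq => u; rewrite mulr1.
  have [c1 hc1] := phi_span _ eig1; have [cf hcf] := phi_span f eigf.
  have fcst : exists r, {ae m, forall x, f x = r}.
    case: k k1 phi {phi_eig phi_free phi_span} c1 hc1 cf hcf =>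
      [|[|//]] _ phi c1 hc1 cf hcf.
      exists 0; apply: (prob_ae_imp _ (proj2 (unif_ae _) hcf)) => x ->.
      by rewrite big_ord0.
    exists (cf ord0 / c1 ord0).
    apply: (prob_ae_imp2 _ (proj2 (unif_ae _) hc1) (proj2 (unif_ae _) hcf)) => x e ->.
    move: e; rewrite !big_ord1 => e; have c10 : c1 ord0 != 0.
      by apply: contra_eq_neq e => ->; rewrite mul0r oner_neq0.
    have phix : phi ord0 x = (c1 ord0)^-1.
      by rewrite -[LHS](mulKf c10) -e mulr1.
    by rewrite phix.
  have [r fr] := fcst.
  have r0 : r = 0.
    rewrite -f0 -[LHS](prob_int_cst m); apply: bm_int_ae => //; first exact: bm_cst.
    by apply: (prob_ae_imp _ fr) => x ->.
  by apply: (prob_ae_imp _ fr) => x ->.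
have := kernel_no_eigen_ae0 bKd Kd_sym noeig.
apply: prob_ae_imp => z /eqP; rewrite subr_eq0 /K /d => /eqP /(mulfI (lt0r_neq0 c_gt0)).
by lra.
Qed.

End C4Spectrum.

Section C4Degenerate.
Context (R : realType) (W : R * R -> R).
Hypothesis hW : is_graphon W.

Local Notation m := (unif R).
Let V := clampW W.
Let V2 := kcomp m V V.
Let V3 := kcomp m V V2.

(** All summands are non-negative, so the single one that glues the edge (0, 1) to itself is at most
    0; [C4_ominus_oplus] evaluates it. *)
Lemma C4_sigma2_le0 : sigma2 C4 W <= 0 ->
  \int[(m \x m)%E]_z (V z * (1 - V z) * V3 z ^+ 2) = 0.
Proof.
have bV : bounded_meas V := bm_clampW hW.
have bV3 : bounded_meas V3 by do 2 apply: bm_kcomp => //.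
pose D (p q : 'I_4 * 'I_4) : R :=
  t_dens (@ominus C4 p.1 p.2 q.1 q.2) W - t_dens (@oplus C4 p.1 p.2 q.1 q.2) W.
have D0 p q : 0 <= D p q.
  rewrite /D /t_dens !(t_markedE hW)// subr_ge0.
  exact: (marked_oplus_le _ _ (bm_clampW hW) (clampW_01 hW)).
rewrite /sigma2 pmulr_rle0; last first.
  by rewrite invr_gt0 mulr_gt0// exprn_gt0// ltr0n card_Aut_gt0.
rewrite (bigD1 (o0, o1))//= (bigD1 (o0, o1) (P := fun q => _))//= => h.
have {h} : D (o0, o1) (o0, o1) <= 0.
  apply: le_trans h; rewrite -addrA lerDl; apply: addr_ge0.
    by apply: sumr_ge0 => q _; exact: (D0 (o0, o1) q).
  by apply: sumr_ge0 => p _; apply: sumr_ge0 => q _; exact: (D0 p q).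
rewrite /D /t_dens !(t_markedE hW)//= C4_ominus_oplus//; last exact: clampW_sym.
move=> h; apply/le_anti; rewrite h /=; apply: Rint_ge0 => z.
by have /andP[? ?] := clampW_01 hW z; rewrite mulr_ge0 ?sqr_ge0// mulr_ge0// subr_ge0.
Qed.

Lemma C4_degenerate_one :
  H_regular C4 W -> 0 < t_dens (mgraph_of C4) W ->
  sigmaH C4 W = 0 ->
  (forall l : R, l != 0 -> exists k, eigen_dim (WH C4 W) l k /\
     (k - (l == dWH C4 W))%N = 0%N) ->
  {ae (@lebesgue_measure R \x @lebesgue_measure R)%E,
    forall z, (I01 `*` I01) z -> W z = 1}.
Proof.
move=> hreg; rewrite (t_dens_C4 hW) => t0 s0 spec.
(* [Num.sqrt] is also 0 at negative arguments, whence an inequality rather than an equation. *)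
have hs : sigma2 C4 W <= 0 by rewrite -sqrtr_eq0; exact/eqP.
have := graphon_rigidity (bm_clampW hW) (clampW_sym hW) (clampW_01 hW) t0
  (C4_sigma2_le0 hs) (C4_const_of_trivial_spectrum hW hreg spec).
move=> V1; apply: unif2_ae; apply: prob_ae_imp V1 => -[x y] V1 [Ix Iy].
by rewrite -V1 clampW_id.
Qed.

End C4Degenerate.

(** * Constancy of the limit variable *)

Section IndependentZeroOne.
Context (R : realType) d (T : measurableType d) (P : probability T R).
Context (I : eqType) (X : I -> T -> R).
Hypothesis mX : forall i, measurable_fun setT (X i).
Hypothesis indX : mutually_independent P xpredT X.
Variable i0 : I.

(** A pi-system that generates the sigma-algebra of the family of all [X i] with i != i0. *)
Definition cylinders_avoiding : set (set T) :=
  [set E | exists s : seq I, exists B : I -> set R,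
     [/\ uniq s, i0 \notin s, forall i, measurable (B i) &
         E = [set w | forall i, i \in s -> B i (X i w)]]].

Local Notation G := cylinders_avoiding.

Let bigI (s : seq I) (B : I -> set R) :
  \big[setI/setT]_(i <- s) (X i @^-1` B i) =
  [set w | forall i, i \in s -> B i (X i w)].
Proof.
elim: s => [|i s ih]; first by rewrite big_nil; apply/seteqP; split.
rewrite big_cons ih; apply/seteqP; split => w /=.
  by move=> [Bi Bs] j; rewrite inE => /predU1P[->//|]; exact: Bs.
by move=> h; split=> [|j js]; apply: h; rewrite inE ?eqxx// js orbT.
Qed.

Let measurable_cyl (s : seq I) (B : I -> set R) : (forall i, measurable (B i)) ->
  measurable [set w | forall i, i \in s -> B i (X i w)].
Proof.
move=> mB; rewrite -bigI; apply: bigsetI_measurable => i _.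
by rewrite -[X in measurable X]setTI; exact: mX.
Qed.

Lemma cylinders_avoiding_measurable : <<s G >> `<=` (@measurable _ T).
Proof.
apply: smallest_sub; first exact: sigma_algebra_measurable.
by move=> _ [s [B [_ _ mB ->]]]; exact: measurable_cyl.
Qed.

Lemma cylinders_avoiding_setI : setI_closed G.
Proof.
move=> _ _ [s1 [B1 [u1 n1 mB1 ->]]] [s2 [B2 [u2 n2 mB2 ->]]].
exists (undup (s1 ++ s2)).
exists (fun i => (if i \in s1 then B1 i else setT) `&`
                 (if i \in s2 then B2 i else setT)); split.
- exact: undup_uniq.
- by rewrite mem_undup mem_cat negb_or n1 n2.
- by move=> i; apply: measurableI; case: ifP.
- apply/seteqP; split => w /=.
    move=> [h1 h2] i _; split; case: ifPn => // hi; [exact: h1|exact: h2].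
  move=> h; split => i hi; have := h i; rewrite mem_undup mem_cat hi ?orbT /=;
    by move=> /(_ isT) [].
Qed.

(** For fixed [B] the events independent of it form a Dynkin system, which contains the cylinders by
    the finite product formula. *)
Lemma indep_cylinders (B : set R) (D : set T) : measurable B -> <<s G >> D ->
  P ((X i0 @^-1` B) `&` D) = (P (X i0 @^-1` B) * P D)%E.
Proof.
move=> mB sD; pose A := X i0 @^-1` B.
have mA : measurable A by rewrite -[A]setTI; exact: mX.
pose T2 := g_sigma_algebraType G.
have mG (S : set T) : @measurable _ T2 S -> measurable S.
  exact: cylinders_avoiding_measurable.
have fA : P A \is a fin_num by exact: fin_num_measure.
move: sD; apply: (@dynkin_induction _ T2 G
  (fun D : set T => P (A `&` D) = (P A * P D)%E)).
- by [].
- exact: cylinders_avoiding_setI.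
- by rewrite setIT probability_setT mule1.
- move=> _ [s [Bs [us ns mBs ->]]].
  pose B' i := if i == i0 then B else Bs i.
  have mB' i : measurable (B' i) by rewrite /B'; case: ifP.
  have u0s : uniq (i0 :: s) by rewrite /= ns.
  have all_T (r : seq I) : all xpredT r by apply/allP.
  have := indX u0s (all_T _) mB'; rewrite !big_cons.
  have -> : X i0 @^-1` B' i0 = A by rewrite /B' eqxx.
  have -> : \big[setI/setT]_(i <- s) (X i @^-1` B' i) =
            \big[setI/setT]_(i <- s) (X i @^-1` Bs i).
    apply: eq_big_seq => i si; rewrite /B'; case: eqVneq => // ii0.
    by rewrite ii0 (negPf ns) in si.
  rewrite bigI => ->; congr (_ * _)%E.
  rewrite -bigI indX//; apply: eq_big_seq => i si; rewrite /B'; case: eqVneq => // ii0.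
  by rewrite ii0 (negPf ns) in si.
- move=> S /mG mS hS.
  have -> : A `&` ~` S = A `\` S by rewrite setDE.
  rewrite measureD//; last by rewrite ltey_eq fA.
  rewrite [X in (_ - X)%E]hS probability_setC//.
  have fS : P S \is a fin_num by exact: fin_num_measure.
  rewrite -(fineK fA) -(fineK fS) -EFinM -!EFinB -EFinM mulrBr mulr1.
  by rewrite [X in (X - _)%E](_ : _ = (fine (P A))%:E)// fineK.
- move=> F mF tF hF; rewrite setI_bigcupr measure_bigcup; last 2 first.
  + by move=> k _; apply: measurableI => //; exact: mG.
  + by apply: trivIset_setIl.
  rewrite measure_bigcup//; last by move=> k _; exact: mG.
  transitivity (\sum_(i <oo | i \in setT) ((fine (P A))%:E * P (F i)))%E.
    by apply: eq_eseriesr => k _; rewrite fineK//; exact: hF.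
  by rewrite nneseriesZl// fineK.
Qed.

(* The event is independent of itself. *)
Lemma indep_zero_one (B : set R) (D : set T) : measurable B -> <<s G >> D ->
  {ae P, forall w, B (X i0 w) <-> D w} ->
  P (X i0 @^-1` B) = 0%E \/ P (X i0 @^-1` B) = 1%E.
Proof.
move=> mB sD BD; pose A := X i0 @^-1` B.
have mA : measurable A by rewrite -[A]setTI; exact: mX.
have mD : measurable D by exact: cylinders_avoiding_measurable.
have mAD : measurable (A `&` D) by exact: measurableI.
have [N [mN N0 PN]] := BD.
have AE (C : set T) : measurable C -> (A `\` C `<=` N) -> (C `\` A `<=` N) -> P C = P A.
  move=> mC AC CA; apply/le_anti/andP; split.
    apply: (@le_trans _ _ (P (A `|` N))).
      rewrite le_measure ?inE//; first exact: measurableU.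
      by move=> w Cw; have [Aw|nAw] := pselect (A w); [left|right; exact: CA].
    by apply: (le_trans (measureU2 _ _ _)) => //; rewrite [X in (_ + X)%E]N0 adde0.
  apply: (@le_trans _ _ (P (C `|` N))).
    rewrite le_measure ?inE//; first exact: measurableU.
    by move=> w Aw; have [Cw|nCw] := pselect (C w); [left|right; exact: AC].
  by apply: (le_trans (measureU2 _ _ _)) => //; rewrite [X in (_ + X)%E]N0 adde0.
have PD : P D = P A.
  by apply: AE => // w [h nh]; apply: PN => /= e; apply: nh; apply/e.
have PAD : P (A `&` D) = P A.
  apply: AE => // w; last by move=> [[? _]].
  by move=> [h nh]; apply: PN => /= e; apply: nh; split=> //; apply/e.
have := indep_cylinders mB sD; rewrite -/A PAD PD.
have fA : P A \is a fin_num by exact: fin_num_measure.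
rewrite -(fineK fA) -EFinM => -[/eqP]; rewrite -subr_eq0 -{1}[fine _]mulr1 -mulrBr.
rewrite mulf_eq0 subr_eq0 => /orP[/eqP->|/eqP <-]; [by left|by right].
Qed.

End IndependentZeroOne.

Lemma normal_itv_gt0 (R : realType) (a b : R) (B : set R) : a < b ->
  measurable B -> `]a, b[ `<=` B -> normal_prob 0 1 B != 0%E.
Proof.
move=> ab mB aB; apply/eqP => B0.
have mI : measurable (`]a, b[%classic : set (measurableTypeR R)) by exact: measurable_itv.
have mpdf : measurable_fun setT (fun x : measurableTypeR R => (normal_pdf 0 1 x)%:E).
  by apply/measurable_EFinP; exact: measurable_normal_pdf.
have : (\int[lebesgue_measure]_(x in `]a, b[) `|(normal_pdf 0 1 x)%:E|)%E = 0%E.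
  apply/le_anti/andP; split; last by apply: integral_ge0.
  rewrite -[leRHS]B0 /normal_prob.
  under eq_integral do rewrite gee0_abs ?lee_fin ?normal_pdf_ge0//.
  apply: ge0_subset_integral => //; first exact: measurable_funTS.
  by move=> x _; rewrite lee_fin normal_pdf_ge0.
move/(ae_eq_integral_abs _ mI (measurable_funTS mpdf)) => [N [mN N0 IN]].
have IN' : `]a, b[%classic `<=` N.
  move=> x Ix; apply: IN => /= /(_ Ix) /= [] /eqP.
  rewrite normal_pdfE ?oner_eq0// gt_eqF// mulr_gt0 ?expR_gt0//.
  by rewrite normal_peak_gt0// oner_eq0.
have : (lebesgue_measure (`]a, b[%classic : set R) <= 0)%E.
  by rewrite -N0 le_measure// inE.
by rewrite lebesgue_measure_itv/= lte_fin ab -EFinB lee_fin leNgt subr_gt0 ab.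
Qed.

(** Countably many conditions on the terms replace one on the limit, so the event is visibly
    measurable for the sigma-algebra of the terms. *)
Lemma cvg_ge_iff (R : realType) (u : nat -> R) (l c : R) :
  u n @[n --> \oo] --> l ->
  (c <= l <-> forall k, exists N, forall n, (N <= n)%N -> c - k.+1%:R^-1 <= u n).
Proof.
move=> ul; split=> [cl k|h].
  have k0 : 0 < k.+1%:R^-1 :> R by rewrite invr_gt0.
  have /cvgrPdist_le/(_ _ k0) [N _ uN] := ul.
  exists N => n Nn; have := uN n Nn; rewrite /= ler_norml => /andP[_].
  by rewrite lerBlDr -lerBlDl; apply: le_trans; rewrite lerD2r.
apply/ler_addgt0Pr => e e0.
have [k ke] : exists k, k.+1%:R^-1 < e.
  have [k _ ke] := near_infty_natSinv_lt (PosNum e0).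
  by exists k; exact: ke (leqnn k).
have [N uN] := h k.
rewrite -lerBlDr; apply: le_trans (_ : c - k.+1%:R^-1 <= _).
  by rewrite lerD2l lerN2 ltW.
rewrite -(cvg_lim _ ul)//; apply: limr_ge; first by apply/cvg_ex; exists l.
by exists N => // n /= Nn; exact: uN.
Qed.

(** * Almost surely constant series of independent Gaussian terms *)

Section NormalSeries.
Context (R : realType) d (T : measurableType d) (P : probability T R).
Context (sigma : R) (lam : nat -> R) (Z : {RV P >-> R}) (Zl : nat -> {RV P >-> R}).

Let V (o : option nat) : T -> R := if o is Some i then Zl i else Z.
Let h (o : option nat) (v : R) : R :=
  if o is Some i then lam i * (v ^+ 2 - 1) else sigma * v.

Let mV o : measurable_fun setT (V o).
Proof. by case: o => [i|]; exact: measurable_funPT. Qed.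

Let mh o : measurable_fun setT (h o).
Proof.
case: o => [i|] /=; last exact: mulrl_measurable.
by apply: measurable_funM => //; apply: measurable_funB.
Qed.

Hypothesis lawZ : has_law Z (normal_prob 0 1).
Hypothesis lawZl : forall i, has_law (Zl i) (normal_prob 0 1).
Hypothesis indep : mutually_independent P xpredT V.

Lemma normal_series_cst_trivial (c : R) :
  {ae P, forall w, sigma * Z w + \sum_(0 <= i < n) lam i * (Zl i w ^+ 2 - 1)
     @[n --> \oo] --> c} ->
  sigma = 0 /\ forall i, lam i = 0.
Proof.
move=> cvg_c.
pose rest o n w : R := (if o == None then 0 else h None (V None w)) +
  \sum_(0 <= i < n | Some i != o) h (Some i) (V (Some i) w).
have rest_cvg o w :
    sigma * Z w + \sum_(0 <= i < n) lam i * (Zl i w ^+ 2 - 1) @[n --> \oo] --> c ->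
    rest o n w @[n --> \oo] --> c - h o (V o w).
  move=> hc.
  have hc' : sigma * Z w + \sum_(0 <= i < n) lam i * (Zl i w ^+ 2 - 1) - h o (V o w)
    @[n --> \oo] --> c - h o (V o w) by apply: cvgB hc _; exact: cvg_cst.
  apply: cvg_trans hc'; apply: near_eq_cvg.
  exists (if o is Some i then i.+1 else 0%N) => // n /= no.
  case: o no => [i|] /= ni; rewrite /rest /=.
    have -> : \sum_(0 <= j < n) lam j * (Zl j w ^+ 2 - 1) =
       lam i * (Zl i w ^+ 2 - 1) +
       \sum_(0 <= j < n | Some j != Some i) lam j * (Zl j w ^+ 2 - 1).
      by rewrite (bigD1_seq i) ?mem_index_iota ?iota_uniq.
    by ring.
  by ring.
(* [rest o] omits the term [o] and tends to c minus that term. By [cvg_ge_iff], [D o] says that this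
   limit is at least [c], so almost surely it coincides with the event that the term is at most 0,
   though it is defined from the other variables. *)
pose D o := [set w | forall k, exists N, forall n, (N <= n)%N ->
   c - k.+1%:R^-1 <= rest o n w].
pose B o := [set v | h o v <= 0].
have mB o : measurable (B o).
  have := measurable_fun_ler (mh o) (measurable_cst (0 : R)).
  by move=> /(_ measurableT [set true] I); rewrite setTI.
have BD o : {ae P, forall w, B o (V o w) <-> D o w}.
  apply: filterS cvg_c => w /(rest_cvg o) hr.
  rewrite /D /= -(cvg_ge_iff c hr) /B /=.
  by split; rewrite lerBrDl gerDr.
have mD o : <<s cylinders_avoiding V o >> (D o).
  pose T2 := g_sigma_algebraType (cylinders_avoiding V o).
  have mV2 o' : o' != o -> @measurable_fun _ _ T2 R setT (V o').
    move=> oo' _ Y mY; rewrite setTI; apply: sub_sigma_algebra.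
    exists [:: o'], (fun=> Y); split => //.
    - by rewrite inE eq_sym.
    - apply/seteqP; split => w /=; first by move=> Yw i; rewrite inE => /eqP->.
      by apply; rewrite inE.
  have mrest n : @measurable_fun _ _ T2 R setT (rest o n).
    apply: measurable_funD.
      case: eqVneq => oN; first exact: (@measurable_cst _ _ T2 R setT 0).
      by apply: (measurableT_comp (mh None)); apply: mV2; rewrite eq_sym.
    under eq_fun do rewrite big_mkcond.
    elim: n => [|n ih].
      by under eq_fun do rewrite big_nil; exact: (@measurable_cst _ _ T2 R setT 0).
    under eq_fun do rewrite big_nat_recr//=.
    apply: measurable_funD => //.
    case: (boolP (Some n != o)) => no; last exact: (@measurable_cst _ _ T2 R setT 0).
    exact: (measurableT_comp (mh (Some n)) (mV2 _ no)).
  suff : @measurable _ T2 (D o) by [].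
  rewrite (_ : D o = \bigcap_k \bigcup_N \bigcap_(n in [set n | (N <= n)%N])
      [set w | c - k.+1%:R^-1 <= rest o n w]).
    apply: bigcapT_measurable => k; apply: bigcupT_measurable => N.
    apply: bigcap_measurable => [|n _]; first by exists N => /=.
    have := measurable_fun_ler (measurable_cst (c - k.+1%:R^-1)) (mrest n).
    by move=> /(_ measurableT [set true] I); rewrite setTI.
  apply/seteqP; split => w /=.
    by move=> Dw k _; have [N hN] := Dw k; exists N => // n /= Nn; exact: hN.
  by move=> hw k; have [N _ hN] := hw k I; exists N => n Nn; exact: hN.
have zero_one o : normal_prob 0 1 (B o) = 0%E \/ normal_prob 0 1 (B o) = 1%E.
  have := indep_zero_one mV indep (mB o) (mD o) (BD o).
  have -> // : P (V o @^-1` B o) = normal_prob 0 1 (B o).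
  by case: o => [i|] /=; [exact: lawZl | exact: lawZ].
have contra o a b a' b' : a < b -> a' < b' ->
   (forall x, a < x < b -> h o x <= 0) -> (forall x, a' < x < b' -> 0 < h o x) -> False.
  move=> ab ab' hB hC.
  have nB : normal_prob 0 1 (B o) != 0%E.
    by apply: (normal_itv_gt0 ab) => // x /=; rewrite in_itv /=; exact: hB.
  have mC : measurable (~` B o) by exact: measurableC.
  have nC : normal_prob 0 1 (~` B o) != 0%E.
    apply: (normal_itv_gt0 ab') => // x /=; rewrite in_itv /= => hx.
    by apply/negP; rewrite -ltNge; exact: hC.
  have [/eqP|B1] := zero_one o; first by rewrite (negPf nB).
  move: nC; rewrite (probability_setC
    (normal_prob 0 1 : probability (measurableTypeR R) R) (mB o)).
  by rewrite [X in (1 - X)%E]B1 subee// eqxx.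
(* The linear term changes sign at 0, and v^2 - 1 changes sign at 1: a non-zero coefficient provides
   an interval for each sign. *)
split=> [|i]; apply: contrapT => /eqP.
  rewrite neq_lt => /orP[s0|s0].
    apply: (@contra None 0 1 (-1) 0) => // x /andP[? ?] /=; nra.
  apply: (@contra None (-1) 0 0 1) => // x /andP[? ?] /=; nra.
rewrite neq_lt => /orP[l0|l0].
  apply: (@contra (Some i) 1 2 0 1) => //; rewrite ?ltr1n// => x /andP[? ?] /=.
    rewrite nmulr_rle0// subr_ge0; nra.
  rewrite nmulr_rgt0// subr_lt0; nra.
apply: (@contra (Some i) 0 1 1 2) => //; rewrite ?ltr1n// => x /andP[? ?] /=.
  rewrite pmulr_rle0// subr_le0; nra.
rewrite pmulr_rgt0// subr_gt0; nra.
Qed.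

End NormalSeries.

(** * Uniqueness of weak limits *)

(** A monotone function has countably many discontinuities, while the interval has positive Lebesgue
    measure. *)
Lemma nondecreasing_continuity_point (R : realType) (F : R -> R) (a b : R) :
  a < b -> {homo F : x y / x <= y} ->
  exists y, a < y < b /\ {for y, continuous F}.
Proof.
move=> ab ndF; apply: contrapT => /forallNP noc.
have disc : `]a, b[%classic `<=` [set x | x \in (`]a, b[) /\ discontinuity F x].
  move=> y /= yab; split=> //.
  have cl : cvg (F x @[x --> y^'-]).
    apply: nondecreasing_at_left_is_cvgr; apply: nearW => r.
      by move=> ? ? ? ? ?; exact: ndF.
    exists (F y) => _ [z /= + <-]; rewrite in_itv /= => /andP[_ zy].
    by apply: ndF; exact: ltW.
  have cr : cvg (F x @[x --> y^'+]).
    apply: nondecreasing_at_right_is_cvgr; apply: nearW => r.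
      by move=> ? ? ? ? ?; exact: ndF.
    exists (F y) => _ [z /= + <-]; rewrite in_itv /= => /andP[yz _].
    by apply: ndF; exact: ltW.
  split=> //; apply/eqP => lr.
  have lF : lim (F x @[x --> y^'-]) <= F y.
    by apply: limr_le => //; near=> z; apply: ndF; exact: ltW.
  have Fr : F y <= lim (F x @[x --> y^'+]).
    by apply: limr_ge => //; near=> z; apply: ndF; exact: ltW.
  have lFy : lim (F x @[x --> y^'-]) = F y by apply/le_anti; rewrite lF lr.
  apply: (noc y); split; first by move: yab; rewrite in_itv.
  apply/left_right_continuousP; split; first by rewrite -lFy.
  by rewrite -lFy lr.
have := sub_countable (subset_card_le disc) (@discontinuity_countable _ a b F
  (fun x y _ _ => ndF x y)).
move/countable_lebesgue_measure0.
rewrite lebesgue_measure_itv/= lte_fin ab -EFinB => -[/eqP].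
by rewrite subr_eq0 gt_eqF.
Unshelve. all: by end_near. Qed.

Section WeakLimits.
Context (R : realType).
Implicit Types (mu nu : probability R R) (c : R).

Lemma dirac_like_cdf mu c : {ae mu, forall x, x = c} -> forall y,
  mu `]-oo, y]%classic = if c <= y then 1%E else 0%E.
Proof.
move=> [N [mN N0 cN]] y; have [cy|yc] := leP c y; last first.
  apply/le_anti/andP; split=> //.
  apply: (@le_trans _ _ (mu N)); last by rewrite [leLHS]N0.
  apply: le_measure; rewrite ?inE//.
  move=> x /=; rewrite in_itv /= => xy; apply: cN => /= xc.
  by move: yc; rewrite -xc ltNge xy.
apply/le_anti/andP; split; first exact: probability_le1.
rewrite -(probability_setT mu) -[leRHS]adde0.
rewrite -[X in (_ + X)%E]N0; apply: le_trans (measureU2 _ _ _) => //.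
apply: le_measure; rewrite ?inE//; first exact: measurableU.
move=> x _; have [xy|yx] := leP x y; first by left; rewrite /= in_itv.
by right; apply: cN => /= xc; move: yx; rewrite xc ltNge cy.
Qed.

Lemma dirac_like_cdf_continuous mu c x : {ae mu, forall x, x = c} -> x != c ->
  {for x, continuous (fun y : R => mu `]-oo, y]%classic)}.
Proof.
move=> muc; rewrite neq_lt => /orP[xc|cx]; apply: cvg_near_cst.
  have : \forall y \near x, y < c by exact: lt_nbhsl.
  apply: filterS => y yc; rewrite !(dirac_like_cdf muc).
  by rewrite !leNgt xc yc.
have : \forall y \near x, c < y by exact: lt_nbhsr.
by apply: filterS => y cy; rewrite !(dirac_like_cdf muc) !ltW.
Qed.

Lemma cdf_continuity_point nu (a b : R) : a < b ->
  exists y, a < y < b /\ {for y, continuous (fun y : R => nu `]-oo, y]%classic)}.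
Proof.
move=> ab; pose F y := fine (nu `]-oo, y]%classic).
have fnu y : nu `]-oo, y]%classic \is a fin_num by exact: fin_num_measure.
have ndF : {homo F : x y / x <= y}.
  move=> x y xy; rewrite /F fine_le// le_measure ?inE//.
  by apply: subset_itvl; rewrite bnd_simp.
have [y [yab cF]] := nondecreasing_continuity_point ab ndF.
exists y; split=> //.
rewrite /prop_for /continuous_at -[X in _ --> X]fineK//.
by apply: cvg_EFin; [exact: nearW|exact: cF].
Qed.

(** Convergence is known at continuity points only. Every interval on one side of [c] contains one
    for [nu], and each point other than [c] is one for [mu]. There the two distribution functions
    agree, so [nu] has no mass below or above [c]. *)
Lemma cvg_in_law_cst d (T : measurableType d) (P : probability T R)
    (X : nat -> T -> R) mu nu c :
  cvg_in_law P X mu -> cvg_in_law P X nu ->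
  {ae mu, forall x, x = c} -> {ae nu, forall x, x = c}.
Proof.
move=> Xmu Xnu muc.
have nu_mu (a b : R) : a < b -> (b <= c \/ c <= a) -> exists2 y, a < y < b &
    nu `]-oo, y]%classic = if c <= y then 1%E else 0%E.
  move=> ab abc; have [y [/andP[ay yb] cy]] := cdf_continuity_point nu ab.
  exists y; first by rewrite ay.
  have yc : y != c.
    case: abc => h; first by rewrite lt_eqF// (lt_le_trans yb).
    by rewrite gt_eqF// (le_lt_trans h).
  rewrite -(dirac_like_cdf muc).
  exact: (cvg_unique _ (Xnu y cy) (Xmu y (dirac_like_cdf_continuous muc yc))).
have nu_lt x : x < c -> nu `]-oo, x]%classic = 0%E.
  move=> xc; have [y /andP[xy yc] nuy] := nu_mu _ _ xc (or_introl (lexx c)).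
  apply/le_anti/andP; split=> //.
  have <- : nu `]-oo, y]%classic = 0%E by rewrite nuy leNgt yc.
  apply: le_measure; rewrite ?inE//.
  by apply: subset_itvl; rewrite bnd_simp ltW.
have nu_gt x : c < x -> nu (~` `]-oo, x]%classic) = 0%E.
  move=> cx; have [y /andP[cy yx] nuy] := nu_mu _ _ cx (or_intror (lexx c)).
  apply/le_anti/andP; split=> //.
  have <- : nu (~` `]-oo, y]%classic) = 0%E.
    by rewrite (probability_setC nu)// nuy ltW// subee.
  apply: le_measure; rewrite ?inE//; [exact: measurableC|exact: measurableC|].
  by apply: subsetC; apply: subset_itvl; rewrite bnd_simp ltW.
(* The complement of the point [c] is covered by countably many half-lines at distance 1/(k+1) from
   it, all null. *)
apply: (@negligibleS _ _ _ nu (\bigcup_k (`]-oo, c - k.+1%:R^-1]%classic `|`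
   ~` `]-oo, c + k.+1%:R^-1]%classic))).
  move=> x /= /eqP; rewrite neq_lt => /orP[xc|cx].
    have [k _ kx] : \forall k \near \oo, k.+1%:R^-1 < c - x.
      by apply: (near_infty_natSinv_lt (PosNum _)); rewrite subr_gt0.
    exists k => //; left; rewrite /= in_itv /= lerBrDl -lerBrDr ltW//.
    exact: kx (leqnn k).
  have [k _ kx] : \forall k \near \oo, k.+1%:R^-1 < x - c.
    by apply: (near_infty_natSinv_lt (PosNum _)); rewrite subr_gt0.
  exists k => //; right; rewrite /= in_itv /=; apply/negP; rewrite -ltNge -ltrBrDl.
  exact: kx (leqnn k).
apply: negligible_bigcup => k; have k0 : 0 < k.+1%:R^-1 :> R by rewrite invr_gt0.
apply: negligibleU.
  by apply/negligibleP => //; apply: nu_lt; rewrite ltrBlDr ltrDl.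
by apply/negligibleP; [exact: measurableC|apply: nu_gt; rewrite ltrDl].
Qed.

End WeakLimits.

Lemma enum_spec_minus_eq0 (R : realType) (K : R -> R -> R) (d : R) (lam : nat -> R) :
  enum_spec_minus K d lam -> (forall i, lam i = 0) ->
  forall l, l != 0 -> exists k, eigen_dim K l k /\ (k - (l == d))%N = 0%N.
Proof.
move=> spec lam0 l l0; have [k [dimk card]] := spec l l0.
exists k; split=> //; move: card.
have -> : [set i | lam i = l] = set0.
  by apply/seteqP; split => // i /=; rewrite lam0 => e; rewrite -e eqxx in l0.
rewrite card_eq_sym card_eq0 => /eqP; case: (k - _)%N => // n n0.
by have : `I_n.+1 0%N by []; rewrite n0.
Qed.

Lemma distribution_ae_cst (R : realType) d (T : measurableType d)
    (P : probability T R) (S : {RV P >-> R}) (c : R) :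
  {ae distribution P S, forall x, x = c} -> {ae P, forall w, S w = c}.
Proof.
move=> [N [mN N0 cN]]; exists (S @^-1` N); split=> //.
  by rewrite -[X in measurable X]setTI; exact: measurable_funPT.
by move=> w /= Sw; exact: cN.
Qed.

Theorem theorem4p8 (R : realType) (W : R * R -> R)
    (hW : is_graphon W)
    (hreg : H_regular C4 W)
    (hpos : 0 < t_dens (mgraph_of C4) W)
    (hne1 : ~ {ae (@lebesgue_measure R \x @lebesgue_measure R)%E,
                forall z, (I01 `*` I01) z -> W z = 1})
    (d' : measure_display) (T' : measurableType d') (P' : probability T' R)
    (lam : nat -> R) (Z : {RV P' >-> R}) (Zl : nat -> {RV P' >-> R})
    (S : {RV P' >-> R})
    (hS : limit_variable C4 W lam Z Zl S) :
  nondegenerate_law (distribution P' S) /\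
  (forall (d : measure_display) (T : measurableType d) (P : probability T R)
     (U : nat -> {RV P >-> R}) (Y : nat -> nat -> {RV P >-> R}),
     graph_sample U Y ->
     cvg_in_law P (Zstat C4 W U Y) (distribution P' S) ->
     forall mu : probability R R,
       cvg_in_law P (Zstat C4 W U Y) mu -> nondegenerate_law mu).
Proof.
have ndS : nondegenerate_law (distribution P' S).
  move=> [c /distribution_ae_cst Sc].
  have [spec [lawZ lawZl] indep Scvg] := hS.
  have cvg_c : {ae P', forall w,
      sigmaH C4 W * Z w + \sum_(0 <= i < n) lam i * (Zl i w ^+ 2 - 1)
        @[n --> \oo] --> c}.
    by apply: filterS2 Sc Scvg => w ->.
  have [s0 lam0] := normal_series_cst_trivial lawZ lawZl indep cvg_c.
  apply: hne1; apply: C4_degenerate_one => //.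
  exact: enum_spec_minus_eq0 spec lam0.
split=> // d T P U Y _ ZS mu Zmu [c muc].
by apply: ndS; exists c; exact: cvg_in_law_cst Zmu ZS muc.
Qed.
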